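(* For integers $m\ge1$ let $$\kappa_{2m}=\frac{2(3m-2)(3m-1)^2}{27(2m-1)},\quad \kappa_{2m-1}=\frac{2(3m-1)(3m-2)^2}{27(2m-1)},\quad \nu_{2m}=\frac{2(3m-2)^3}{27(2m-1)},\quad \nu_{2m-1}=\frac{2(3m-1)^3}{27(2m-1)}.$$ If $x\in\mathbb{C}$ with $\Re(x)>0$, then $$\frac{\Gamma^3\left(\frac12\left(x+\frac13\right)\right)}{\Gamma^3\left(\frac12\left(x+\frac53\right)\right)} =\cfrac{2}{\left(x^2-\frac19\right)/2+\mathbf{K}_{n=1}^{\infty}\left(\frac{\kappa_n}{c_n(x)}\right)} =\cfrac{2}{\left(x^2-1\right)/2+\mathbf{K}_{n=1}^{\infty}\left(\frac{\nu_n}{d_n(x)}\right)},$$ where $c_{2m-1}(x)=1$, $c_{2m}(x)=x^2-\frac19$, $d_{2m-1}(x)=1$ and $d_{2m}(x)=x^2-1$ for all $m\ge1$.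
   Context: For complex sequences $(a_n)_{n\ge1}$, $(b_n)_{n\ge0}$, the continued fraction $b_0+\mathbf{K}_{n=1}^{\infty}\left(\frac{a_n}{b_n}\right)=b_0+\cfrac{a_1}{b_1+\cfrac{a_2}{b_2+\cdots}}$ is defined as the limit as $n\to\infty$ of its $n$th approximant $b_0+\mathbf{K}_{k=1}^{n}\left(\frac{a_k}{b_k}\right)=b_0+\cfrac{a_1}{b_1+\cfrac{a_2}{\ddots+\cfrac{a_n}{b_n}}}$. The notation $\cfrac{a_0}{b_0+\mathbf{K}_{m=1}^{\infty}\left(\frac{a_m}{b_m}\right)}$ means $a_0$ divided by $b_0+\mathbf{K}_{m=1}^{\infty}\left(\frac{a_m}{b_m}\right)$. $\Gamma$ is the Gamma function and $\Gamma^3(z)=(\Gamma(z))^3$.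
   Formalization: At x=1/3 (first fraction) and x=1 (second fraction) all even-index partial denominators vanish and the sequence of approximants has no limit; there the limit is taken only over approximants whose last partial denominator is nonzero. *)

(* Defs.v *)
From Stdlib Require Import Reals Arith Lra Lia.
From Coquelicot Require Import Coquelicot.
Open Scope R_scope.

(** * The Gamma function *)

Definition Cexp (z : C) : C :=
  (exp (Re z) * cos (Im z), exp (Re z) * sin (Im z)).

(* Principal power of a positive real base. *)
Definition Rcpow (t : R) (z : C) : C := Cexp (z * RtoC (ln t))%C.

(* Rising factorial z (z+1) ... (z+k-1). *)
Fixpoint Cpoch (z : C) (k : nat) : C :=
  match k with
  | O => RtoC 1
  | S k' => (Cpoch z k' * (z + RtoC (INR k')))%C
  end.

Definition C_Lim_seq (u : nat -> C) : C :=
  (real (Lim_seq (fun n => Re (u n))), real (Lim_seq (fun n => Im (u n)))).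

(* Euler's limit  Gamma(z) = lim k! k^(z-1) / (z)_k, valid for every complex z
   other than 0, -1, -2, ...  (Andrews-Askey-Roy, "Special Functions",
   Definition 1.1.1); values at the poles are meaningless. *)
Definition Gamma (z : C) : C :=
  C_Lim_seq (fun k =>
    (RtoC (INR (fact k)) * Rcpow (INR k) (z - RtoC 1) / Cpoch z k)%C).

(** * Continued fractions *)

(* Finite fractions are evaluated in the Riemann sphere, [None] being the point
   at infinity, so that vanishing inner denominators do not meet the convention
   [/ 0 = 0] of [Cinv]. *)
Definition sphere := option C.

Definition sphere_add (b : C) (w : sphere) : sphere :=
  match w with
  | Some z => Some (b + z)%C
  | None => None
  end.

(* [a / 0] is the point at infinity: for continued fractions [a <> 0]. *)
Definition sphere_div (a : C) (w : sphere) : sphere :=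
  match w with
  | Some z => if Ceq_dec z (RtoC 0) then None else Some (a / z)%C
  | None => Some (RtoC 0)
  end.

(* a_k / (b_k + a_{k+1} / (b_{k+1} + ... + a_{k+n-1} / b_{k+n-1})), n levels. *)
Fixpoint cf_tail (a b : nat -> C) (k n : nat) : sphere :=
  match n with
  | O => Some (RtoC 0)
  | S n' => sphere_div (a k) (sphere_add (b k) (cf_tail a b (S k) n'))
  end.

Definition cf_approximant (b0 : C) (a b : nat -> C) (n : nat) : sphere :=
  sphere_add b0 (cf_tail a b 1 n).

(* [l] is the (finite) limit of the approximants of b0 + K (a_n / b_n).
   The n-th approximant ends in the quotient a_n / b_n and is regarded as
   undefined when b_n = 0; the limit is taken over the remaining indices, of
   which there must be infinitely many.  If no b_n vanishes this is ordinary
   convergence of all the approximants.  Vanishing b_n occur below only for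
   [c x] at x = 1/3 and [d x] at x = 1 (for 0 < Re x): there the approximants
   of even order, read on the sphere, would all be 0, while those of odd order
   have a nonzero limit. *)
Definition is_cf (b0 : C) (a b : nat -> C) (l : C) : Prop :=
  (forall N : nat, exists n : nat, (N <= n)%nat /\ b n <> RtoC 0) /\
  (forall eps : posreal, exists N : nat, forall n : nat,
     (N <= n)%nat -> b n <> RtoC 0 ->
     exists w : C, cf_approximant b0 a b n = Some w /\ Cmod (w - l) < eps).

(** * The coefficients *)

(* [half_up (2 * m) = half_up (2 * m - 1) = m] for [1 <= m]. *)
Definition half_up (n : nat) : nat := Nat.div2 (S n).

Definition kappa (n : nat) : C :=
  let m := INR (half_up n) in
  RtoC (if Nat.even n
        then 2 * (3 * m - 2) * (3 * m - 1) ^ 2 / (27 * (2 * m - 1))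
        else 2 * (3 * m - 1) * (3 * m - 2) ^ 2 / (27 * (2 * m - 1))).

Definition nu (n : nat) : C :=
  let m := INR (half_up n) in
  RtoC (if Nat.even n
        then 2 * (3 * m - 2) ^ 3 / (27 * (2 * m - 1))
        else 2 * (3 * m - 1) ^ 3 / (27 * (2 * m - 1))).

Definition c (x : C) (n : nat) : C :=
  if Nat.even n then (x ^ 2 - RtoC (1 / 9))%C else RtoC 1.

Definition d (x : C) (n : nat) : C :=
  if Nat.even n then (x ^ 2 - RtoC 1)%C else RtoC 1.

Lemma even_double (m : nat) : Nat.even (2 * m) = true.
Proof. apply Nat.even_spec; exists m; reflexivity. Qed.

Lemma even_double_pred (m : nat) : (1 <= m)%nat -> Nat.even (2 * m - 1) = false.
Proof.
intros hm; replace (2 * m - 1)%nat with (S (2 * (m - 1))) by lia.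
rewrite Nat.even_succ, <- Nat.negb_even, even_double; reflexivity.
Qed.

Lemma half_up_double (m : nat) : half_up (2 * m) = m.
Proof. apply Nat.div2_succ_double. Qed.

Lemma half_up_double_pred (m : nat) : (1 <= m)%nat -> half_up (2 * m - 1) = m.
Proof.
intros hm; unfold half_up; replace (S (2 * m - 1)) with (2 * m)%nat by lia.
apply Nat.div2_double.
Qed.

Lemma kappa_even (m : nat) :
  kappa (2 * m) =
  RtoC (2 * (3 * INR m - 2) * (3 * INR m - 1) ^ 2 / (27 * (2 * INR m - 1))).
Proof. unfold kappa; rewrite even_double, half_up_double; reflexivity. Qed.

Lemma kappa_odd (m : nat) : (1 <= m)%nat ->
  kappa (2 * m - 1) =
  RtoC (2 * (3 * INR m - 1) * (3 * INR m - 2) ^ 2 / (27 * (2 * INR m - 1))).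
Proof.
intros hm; unfold kappa; rewrite even_double_pred, half_up_double_pred by exact hm.
reflexivity.
Qed.

Lemma nu_even (m : nat) :
  nu (2 * m) = RtoC (2 * (3 * INR m - 2) ^ 3 / (27 * (2 * INR m - 1))).
Proof. unfold nu; rewrite even_double, half_up_double; reflexivity. Qed.

Lemma nu_odd (m : nat) : (1 <= m)%nat ->
  nu (2 * m - 1) = RtoC (2 * (3 * INR m - 1) ^ 3 / (27 * (2 * INR m - 1))).
Proof.
intros hm; unfold nu; rewrite even_double_pred, half_up_double_pred by exact hm.
reflexivity.
Qed.

(* Main.v *)
Require Import Defs.
From Stdlib Require Import Reals Arith Lra Lia.
From Coquelicot Require Import Coquelicot.
Open Scope R_scope.

(** Both continued fractions come from the recurrence

      a_n (y_(n+1) - y_n) - c_n (y_n - y_(n-1)) = (x^2 - 1) y_n     (n >= 1)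

    with a_n = nu_(2n+1) and c_n = nu_(2n), the recurrence of the Wilson
    polynomials with parameters 1/2, 1/6, 1/6, 1/6.  As a_(-n) = c_n it is
    invariant under n -> -n; [numer] is its even solution and [denom] its odd
    one.  Up to a common factor the approximants of odd order of either fraction
    are numer_n / denom_n, and those of even order are the quotients of
    y_(n+1) - theta_n y_n for y = numer and y = denom, where theta_n = 1 for the
    fraction in nu and theta_n = ((3n+1)/(3n+2))^2 for the fraction in kappa.
    Thus both fractions have the same limit l(x) as soon as one controls the two
    solutions for large n ([is_cf_of_recessive]).

    Solutions grow like n^(x-1) or, exceptionally, like n^(-x-1).  If the
    combination numer - l denom is of the second kind ([Recessive]), its
    Casoratian with denom forces denom to be of the first kind, and as Re x > 0
    all approximants tend to l.  In even order the leading terms of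
    denom_(n+1) - theta_n denom_n cancel only for x = 1 (nu) or x = 1/3 (kappa),
    exactly where the partial denominators of even index vanish.

    To find l, let Re (x^2) >= 1 first: the ratios denom_(n+1) / denom_n - 1 stay
    in the right half-plane, which makes the Riccati recursion that they satisfy
    a contraction, so that denom grows like n^(x-1); then numer / denom
    converges, and the error is of the recessive size.  For the other x one
    descends.  A [ladder] maps the solutions for x to those for x + 2 and sends
    numer to (3x+1)^3 numer and denom to (3x+5)^3 denom.  Since the recurrence
    only involves x^2, the ladder at -x-2 leads back from x + 2 to x, and on a
    recessive solution its leading terms do not cancel.  This yields l(x) for all
    Re x > 0, together with the functional equation
    l(x) = ((3x+1)/(3x+5))^3 l(x+2) ([Recessive_step]).

    Iterating it, l(x) = ((a)_k / (b)_k)^3 l(x+2k), where a = (x + 1/3)/2 and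
    b = (x + 5/3)/2.  Far to the right all tails of the fraction lie in the right
    half-plane, so that l(y) = y^2/2 + O(1) and l(x+2k) ~ 2 k^2.  But b - a = 2/3,
    so Euler's limit for Gamma(a)^3 / Gamma(b)^3 is that of
    ((b)_k / (a)_k)^3 / k^2 = l(x+2k) / (k^2 l(x)), which is 2 / l(x). *)

(** * Limits of complex sequences *)

Lemma neq0_of_Re (z : C) : Re z <> 0 -> z <> RtoC 0.
Proof. intros H E; apply H; now rewrite E. Qed.

(** Convergence is encoded as a real limit so that the squeeze lemmas for real
sequences apply to it directly. *)
Definition Ccv (u : nat -> C) (l : C) : Prop :=
  is_lim_seq (fun n => Cmod (u n - l)%C) 0.

Lemma is_lim_seq_squeeze_0 (u v : nat -> R) :
  eventually (fun n => 0 <= u n <= v n) -> is_lim_seq v 0 -> is_lim_seq u 0.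
Proof.
intros H Hv; apply (is_lim_seq_le_le_loc (fun _ => 0) u v); auto.
apply is_lim_seq_const.
Qed.

Lemma Ccv_le (u : nat -> C) (l : C) (v : nat -> R) :
  eventually (fun n => Cmod (u n - l)%C <= v n) -> is_lim_seq v 0 -> Ccv u l.
Proof.
intros [N H]; apply is_lim_seq_squeeze_0; exists N; intros n Hn.
split; [apply Cmod_ge_0 | auto].
Qed.

Lemma Ccv_ext_ev (u v : nat -> C) (l : C) :
  eventually (fun n => u n = v n) -> Ccv u l -> Ccv v l.
Proof.
intros [N H]; apply is_lim_seq_ext_loc; exists N; intros n Hn.
now rewrite H.
Qed.

Lemma Ccv_ext (u v : nat -> C) (l : C) :
  (forall n, u n = v n) -> Ccv u l -> Ccv v l.
Proof. intros H; apply Ccv_ext_ev; exists 0%nat; auto. Qed.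

Lemma Ccv_eq (u : nat -> C) (l m : C) : l = m -> Ccv u l -> Ccv u m.
Proof. now intros ->. Qed.

Lemma Ccv_const (l : C) : Ccv (fun _ => l) l.
Proof.
apply (is_lim_seq_ext (fun _ => 0)); [|apply is_lim_seq_const].
intros n; replace (l - l)%C with (RtoC 0) by ring; now rewrite Cmod_0.
Qed.

Lemma Ccv_plus (u v : nat -> C) (l m : C) :
  Ccv u l -> Ccv v m -> Ccv (fun n => u n + v n)%C (l + m)%C.
Proof.
intros Hu Hv.
apply Ccv_le with (fun n => Cmod (u n - l)%C + Cmod (v n - m)%C).
- exists 0%nat; intros n _.
  replace (u n + v n - (l + m))%C with ((u n - l) + (v n - m))%C by ring.
  apply Cmod_triangle.
- replace 0 with (0 + 0) by ring; now apply is_lim_seq_plus'.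
Qed.

Lemma Ccv_mult (u v : nat -> C) (l m : C) :
  Ccv u l -> Ccv v m -> Ccv (fun n => u n * v n)%C (l * m)%C.
Proof.
intros Hu Hv.
apply Ccv_le with (fun n => Cmod (u n - l)%C * Cmod (v n - m)%C
  + (Cmod l * Cmod (v n - m)%C + Cmod m * Cmod (u n - l)%C)).
- exists 0%nat; intros n _.
  replace (u n * v n - l * m)%C
    with ((u n - l) * (v n - m) + (l * (v n - m) + m * (u n - l)))%C by ring.
  rewrite <- !Cmod_mult.
  eapply Rle_trans; [apply Cmod_triangle | apply Rplus_le_compat_l, Cmod_triangle].
- replace 0 with (0 * 0 + (Cmod l * 0 + Cmod m * 0)) by ring.
  assert (K := fun k w (H : is_lim_seq w 0) =>
    is_lim_seq_mult' _ _ k 0 (is_lim_seq_const k) H).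
  apply is_lim_seq_plus'; [apply is_lim_seq_mult' | apply is_lim_seq_plus'; apply K];
    assumption.
Qed.

Lemma Ccv_opp (u : nat -> C) (l : C) : Ccv u l -> Ccv (fun n => - u n)%C (- l)%C.
Proof.
intros H; replace (- l)%C with (RtoC (-1) * l)%C by ring.
apply (Ccv_ext (fun n => RtoC (-1) * u n)%C); [intros n; ring|].
apply Ccv_mult; [apply Ccv_const | exact H].
Qed.

Lemma Ccv_minus (u v : nat -> C) (l m : C) :
  Ccv u l -> Ccv v m -> Ccv (fun n => u n - v n)%C (l - m)%C.
Proof. intros Hu Hv; apply Ccv_plus; [|apply Ccv_opp]; assumption. Qed.

Lemma Ccv_pow (u : nat -> C) (l : C) (k : nat) :
  Ccv u l -> Ccv (fun n => u n ^ k)%C (l ^ k)%C.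
Proof.
intros H; induction k; [exact (Ccv_const (RtoC 1)) | simpl; now apply Ccv_mult].
Qed.

Lemma Ccv_lipschitz (f : C -> R) (u : nat -> C) (l : C) :
  (forall z w, Rabs (f z - f w) <= Cmod (z - w)%C) ->
  Ccv u l -> is_lim_seq (fun n => f (u n)) (f l).
Proof.
intros Hf H.
apply is_lim_seq_ext with (fun n => (f (u n) - f l) + f l); [intros n; ring|].
replace (Finite (f l)) with (Finite (0 + f l)) by (f_equal; ring).
apply is_lim_seq_plus'; [|apply is_lim_seq_const].
apply is_lim_seq_abs_0, is_lim_seq_squeeze_0 with (2 := H).
exists 0%nat; intros n _; split; [apply Rabs_pos | apply Hf].
Qed.

Lemma Cmod_lipschitz (z w : C) : Rabs (Cmod z - Cmod w) <= Cmod (z - w)%C.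
Proof.
assert (H1 := Cmod_triangle (z - w)%C w).
assert (H2 := Cmod_triangle (w - z)%C z).
replace (z - w + w)%C with z in H1 by ring.
replace (w - z + z)%C with w in H2 by ring.
replace (w - z)%C with (- (z - w))%C in H2 by ring.
rewrite Cmod_opp in H2.
apply Rabs_le; lra.
Qed.

Lemma Re_lipschitz (z w : C) : Rabs (Re z - Re w) <= Cmod (z - w)%C.
Proof. apply (re_le_Cmod (z - w)%C). Qed.

Lemma Rabs_Im_le_Cmod (z : C) : Rabs (Im z) <= Cmod z.
Proof. eapply Rle_trans; [apply Rmax_r | apply Rmax_Cmod]. Qed.

Lemma Im_lipschitz (z w : C) : Rabs (Im z - Im w) <= Cmod (z - w)%C.
Proof. apply (Rabs_Im_le_Cmod (z - w)%C). Qed.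

Lemma Cmod_le_Re_Im (z : C) : Cmod z <= Rabs (Re z) + Rabs (Im z).
Proof.
destruct z as [a b].
replace (a, b) with (RtoC a + Ci * RtoC b)%C at 1
  by (apply injective_projections; simpl; ring).
eapply Rle_trans; [apply Cmod_triangle|].
rewrite Cmod_mult, Cmod_Ci, !Cmod_R; simpl; lra.
Qed.

Lemma Ccv_Cmod (u : nat -> C) (l : C) :
  Ccv u l -> is_lim_seq (fun n => Cmod (u n)) (Cmod l).
Proof. apply Ccv_lipschitz, Cmod_lipschitz. Qed.

Lemma Ccv_Re (u : nat -> C) (l : C) :
  Ccv u l -> is_lim_seq (fun n => Re (u n)) (Re l).
Proof. apply Ccv_lipschitz, Re_lipschitz. Qed.

Lemma Ccv_Im (u : nat -> C) (l : C) :
  Ccv u l -> is_lim_seq (fun n => Im (u n)) (Im l).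
Proof. apply Ccv_lipschitz, Im_lipschitz. Qed.

Lemma Ccv_unique (u : nat -> C) (l m : C) : Ccv u l -> Ccv u m -> l = m.
Proof.
intros Hl Hm; destruct l as [l1 l2], m as [m1 m2].
f_equal.
- assert (H1 := is_lim_seq_unique _ _ (Ccv_Re _ _ Hl)).
  assert (H2 := is_lim_seq_unique _ _ (Ccv_Re _ _ Hm)).
  rewrite H1 in H2; now injection H2.
- assert (H1 := is_lim_seq_unique _ _ (Ccv_Im _ _ Hl)).
  assert (H2 := is_lim_seq_unique _ _ (Ccv_Im _ _ Hm)).
  rewrite H1 in H2; now injection H2.
Qed.

Lemma Ccv_C_Lim_seq (u : nat -> C) (l : C) : Ccv u l -> C_Lim_seq u = l.
Proof.
intros H; unfold C_Lim_seq.
rewrite (is_lim_seq_unique _ _ (Ccv_Re _ _ H)), (is_lim_seq_unique _ _ (Ccv_Im _ _ H)).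
now destruct l.
Qed.

Lemma is_lim_seq_ev_gt (u : nat -> R) (l a : R) :
  is_lim_seq u l -> a < l -> eventually (fun n => a < u n).
Proof.
intros H Ha; apply is_lim_seq_spec in H.
destruct (H (mkposreal (l - a) (proj2 (Rlt_0_minus _ _) Ha))) as [N HN].
exists N; intros n Hn; specialize (HN n Hn); simpl in HN.
apply Rabs_def2 in HN; lra.
Qed.

Lemma is_lim_seq_ev_lt (u : nat -> R) (l a : R) :
  is_lim_seq u l -> l < a -> eventually (fun n => u n < a).
Proof.
intros H Ha; apply is_lim_seq_opp in H.
destruct (is_lim_seq_ev_gt _ (- l) (- a) H) as [N HN]; [lra|].
exists N; intros n Hn; specialize (HN n Hn); lra.
Qed.

Lemma Ccv_ev_neq0 (u : nat -> C) (l : C) :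
  Ccv u l -> l <> RtoC 0 -> eventually (fun n => u n <> RtoC 0).
Proof.
intros H Hl.
destruct (is_lim_seq_ev_gt _ _ 0 (Ccv_Cmod _ _ H) (proj1 (Cmod_gt_0 l) Hl))
  as [N HN].
exists N; intros n Hn; apply Cmod_gt_0; auto.
Qed.

Lemma Ccv_inv (u : nat -> C) (l : C) :
  l <> RtoC 0 -> Ccv u l -> Ccv (fun n => / u n)%C (/ l)%C.
Proof.
intros Hl H.
destruct (Ccv_ev_neq0 _ _ H Hl) as [N HN].
apply Ccv_le with (fun n => Cmod (u n - l)%C * / (Cmod (u n) * Cmod l)).
- exists N; intros n Hn; specialize (HN n Hn).
  replace (/ u n - / l)%C with (- (u n - l) * / (u n * l))%C
    by (field; auto).
  rewrite Cmod_mult, Cmod_opp, Cmod_inv, Cmod_mult by now apply Cmult_neq_0.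
  apply Rle_refl.
- assert (Hm : 0 < Cmod l) by now apply Cmod_gt_0.
  replace 0 with (0 * / (Cmod l * Cmod l)) by ring.
  apply is_lim_seq_mult'; [exact H|].
  apply (is_lim_seq_inv (fun n => Cmod (u n) * Cmod l) (Cmod l * Cmod l)).
  + apply is_lim_seq_mult'; [now apply Ccv_Cmod | apply is_lim_seq_const].
  + intros E; injection E; nra.
Qed.

Lemma Ccv_div (u v : nat -> C) (l m : C) :
  m <> RtoC 0 -> Ccv u l -> Ccv v m -> Ccv (fun n => u n / v n)%C (l / m)%C.
Proof. intros Hm Hu Hv; apply Ccv_mult; [|apply Ccv_inv]; assumption. Qed.

Lemma Ccv_incr_1 (u : nat -> C) (l : C) : Ccv u l -> Ccv (fun n => u (S n)) l.
Proof. apply (is_lim_seq_incr_1 (fun n => Cmod (u n - l)%C)). Qed.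

Lemma Ccv_Cmod_0 (u : nat -> C) : is_lim_seq (fun n => Cmod (u n)) 0 -> Ccv u (RtoC 0).
Proof.
apply is_lim_seq_ext; intros n; f_equal; ring.
Qed.

(** The Cauchy criterion in telescoped form, in which it is met both for infinite
products and for series with power decay. *)
Lemma Ccv_of_decrements (u : nat -> C) (v : nat -> R) (N : nat) :
  (forall n m, (N <= n <= m)%nat -> Cmod (u m - u n)%C <= v n - v m) ->
  is_lim_seq v 0 ->
  exists l, Ccv u l.
Proof.
intros H Hv.
assert (HC : forall f : C -> R,
  (forall z w, Rabs (f z - f w) <= Cmod (z - w)%C) ->
  exists l : R, is_lim_seq (fun n => f (u n)) l).
{ intros f Hf.
  assert (Hc : ex_lim_seq_cauchy (fun n => f (u n))).
  { intros eps; apply is_lim_seq_spec in Hv.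
    destruct (Hv (pos_div_2 eps)) as [M HM]; simpl in HM.
    exists (N + M)%nat.
    assert (K : forall n m, (N + M <= n <= m)%nat ->
      Rabs (f (u m) - f (u n)) < eps).
    { intros n m Hnm; eapply Rle_lt_trans; [apply Hf|].
      eapply Rle_lt_trans; [apply H; lia|].
      assert (A1 := HM n ltac:(lia)); assert (A2 := HM m ltac:(lia)).
      apply Rabs_def2 in A1, A2; lra. }
    intros n m Hn Hm; destruct (Nat.le_ge_cases n m) as [L|L].
    - rewrite Rabs_minus_sym; apply K; lia.
    - apply K; lia. }
  apply ex_lim_seq_cauchy_corr in Hc; destruct Hc as [l Hl].
  now exists l. }
destruct (HC Re) as [a Ha]; [apply Re_lipschitz|].
destruct (HC Im) as [b Hb]; [apply Im_lipschitz|].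
exists (a, b).
apply Ccv_le with (fun n => Rabs (Re (u n) - a) + Rabs (Im (u n) - b)).
- exists 0%nat; intros n _; apply (Cmod_le_Re_Im (u n - (a, b))%C).
- replace 0 with (Rabs (a - a) + Rabs (b - b))
    by (rewrite !Rminus_diag, Rabs_R0; ring).
  apply is_lim_seq_plus'; apply (is_lim_seq_abs _ (Finite _));
    (apply is_lim_seq_minus'; [assumption | apply is_lim_seq_const]).
Qed.

Lemma Ccv_dist_le (u : nat -> C) (l : C) (v : nat -> R) (n : nat) (b : R) :
  Ccv u l -> is_lim_seq v b ->
  eventually (fun m => Cmod (u m - u n)%C <= v m) -> Cmod (u n - l)%C <= b.
Proof.
intros Hu Hv He.
assert (H := Ccv_Cmod _ _ (Ccv_minus _ _ _ _ Hu (Ccv_const (u n)))).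
assert (K := is_lim_seq_le_loc _ _ _ _ He H Hv); simpl in K.
replace (u n - l)%C with (- (l - u n))%C by ring; now rewrite Cmod_opp.
Qed.

(** * Sequences of power growth *)

Definition nC (n : nat) : C := RtoC (INR n).

Lemma nC_S (n : nat) : nC (S n) = (nC n + RtoC 1)%C.
Proof. unfold nC; now rewrite S_INR, RtoC_plus. Qed.

Lemma nC_neq0 (n : nat) : (1 <= n)%nat -> nC n <> RtoC 0.
Proof. intros Hn H; apply RtoC_inj in H; revert H; apply not_0_INR; lia. Qed.

Lemma is_lim_seq_inv_INR : is_lim_seq (fun n => / INR n) 0.
Proof.
replace (Finite 0) with (Rbar_inv p_infty) by reflexivity.
apply is_lim_seq_inv; [apply is_lim_seq_INR | discriminate].
Qed.

Lemma Ccv_inv_nC : Ccv (fun n => / nC n)%C (RtoC 0).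
Proof.
apply Ccv_Cmod_0, is_lim_seq_ext_loc with (fun n => / INR n).
- exists 1%nat; intros n Hn; rewrite Cmod_inv by now apply nC_neq0.
  unfold nC; rewrite Cmod_R, Rabs_pos_eq by apply pos_INR; reflexivity.
- apply is_lim_seq_inv_INR.
Qed.

(** The factors [1 - eps / n] have product [0] because the harmonic series
diverges; that divergence is measured by [ln (n + 1) - ln n <= 1 / n]. *)
Lemma harmonic_contraction (u eta : nat -> R) (eps : R) :
  0 < eps -> is_lim_seq eta 0 ->
  eventually (fun n => 0 <= u n) ->
  eventually (fun n => u (S n) <= (1 - eps / INR n) * u n + eta n / INR n) ->
  is_lim_seq u 0.
Proof.
intros He Heta [N1 Hpos] [N2 Hrec]; apply is_lim_seq_spec; intros delta; simpl.
assert (Hd := cond_pos delta).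
destruct (is_lim_seq_ev_lt _ _ (eps * (delta / 2)) Heta) as [N3 Hsmall]; [nra|].
destruct (nfloor_ex (eps + 1)) as [N4 [_ HN4]]; [lra|].
set (N := (N1 + N2 + N3 + S N4)%nat).
assert (HN : forall n, (N <= n)%nat -> eps + 1 < INR n).
{ intros n Hn; eapply Rlt_le_trans; [exact HN4|].
  rewrite <- S_INR; apply le_INR; unfold N in Hn; lia. }
set (h := delta / 2).
set (D := Rmax (u N - h) 0).
assert (HD : 0 <= D) by apply Rmax_r.
assert (Key : forall k, (u (N + k)%nat - h)
  * (1 + eps * (ln (INR (N + k)) - ln (INR N))) <= D).
{ induction k as [|k IH].
  - rewrite Nat.add_0_r, Rminus_diag, Rmult_0_r, Rplus_0_r, Rmult_1_r.
    apply Rmax_l.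
  - rewrite Nat.add_succ_r.
    set (n := (N + k)%nat) in *.
    assert (Hn : (N <= n)%nat) by (unfold n; lia).
    assert (Gn := HN n Hn).
    assert (R1 := Hrec n ltac:(unfold N in *; lia)).
    assert (R2 := Hsmall n ltac:(unfold N in *; lia)).
    fold h in R2.
    assert (Hi : 0 < / INR n) by (apply Rinv_0_lt_compat; lra).
    assert (Hq : eps / INR n < 1) by (apply Rlt_div_l; lra).
    assert (Hq0 : 0 < eps / INR n) by (apply Rdiv_lt_0_compat; lra).
    assert (R3 : u (S n) - h <= (1 - eps / INR n) * (u n - h)).
    { assert (eta n / INR n <= eps / INR n * h) by (unfold Rdiv; nra).
      lra. }
    assert (Hln0 : ln (INR N) <= ln (INR n)).
    { apply ln_le; [assert (K := HN N (le_n _)); lra | now apply le_INR]. }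
    assert (Hln : ln (INR (S n)) <= ln (INR n) + / INR n).
    { assert (E : INR (S n) = INR n * (1 + / INR n))
        by (rewrite S_INR; field; lra).
      rewrite E, ln_mult by lra.
      assert (K := exp_ineq1_le (/ INR n)).
      assert (L := ln_le (1 + / INR n) (exp (/ INR n)) ltac:(lra) K).
      rewrite ln_exp in L; lra. }
    assert (Hln1 : ln (INR n) <= ln (INR (S n))).
    { apply ln_le; [lra | apply le_INR; lia]. }
    set (A := 1 + eps * (ln (INR n) - ln (INR N))) in *.
    assert (HA : 1 <= A) by (unfold A; nra).
    set (A' := 1 + eps * (ln (INR (S n)) - ln (INR N))) in *.
    assert (HA' : 1 <= A') by (unfold A'; nra).
    set (q := eps / INR n) in *.
    assert (HAA : A' <= A * (1 + q)).
    { assert (A' <= A + q) by (unfold A, A', q, Rdiv; nra). nra. }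
    destruct (Rle_lt_dec (u (S n) - h) 0) as [L|L]; [nra|].
    assert (Hun : 0 < u n - h) by nra.
    apply Rle_trans with ((u (S n) - h) * (A * (1 + q))).
    { apply Rmult_le_compat_l; lra. }
    apply Rle_trans with ((1 - q) * (u n - h) * (A * (1 + q))).
    { apply Rmult_le_compat_r; nra. }
    apply Rle_trans with (2 := IH).
    replace ((1 - q) * (u n - h) * (A * (1 + q)))
      with ((1 - q * q) * ((u n - h) * A)) by ring.
    assert (0 <= (u n - h) * A) by nra.
    nra. }
assert (HL : is_lim_seq (fun n => ln (INR n)) p_infty).
{ apply (is_lim_comp_seq ln INR p_infty p_infty); [apply is_lim_ln_p| |].
  - exists 0%nat; discriminate.
  - apply is_lim_seq_INR. }
apply is_lim_seq_spec in HL.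
destruct (HL (ln (INR N) + D / (h * eps))) as [M HM].
exists (N + M)%nat; intros n Hn.
assert (K := Key (n - N)%nat).
replace (N + (n - N))%nat with n in K by lia.
assert (L := HM n ltac:(lia)).
assert (P := Hpos n ltac:(unfold N in *; lia)).
rewrite Rminus_0_r, Rabs_pos_eq by exact P.
assert (Hh : 0 < h) by (unfold h; lra).
assert (Hh2 : h + h = delta) by (unfold h; lra).
assert (L2 : D < h * (eps * (ln (INR n) - ln (INR N)))).
{ assert (E : D = h * (eps * (D / (h * eps)))) by (field; lra).
  rewrite E at 1; apply Rmult_lt_compat_l; [lra|].
  apply Rmult_lt_compat_l; lra. }
destruct (Rlt_le_dec (u n) delta) as [|G]; [assumption|].
exfalso.
set (Z := eps * (ln (INR n) - ln (INR N))) in *.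
assert (0 < Z) by nra.
nra.
Qed.

Ltac ccv := repeat match goal with
  | |- Ccv (fun n => ?a) _ => apply Ccv_const
  | |- Ccv (fun n => (@?a n + @?b n)%C) _ => apply Ccv_plus
  | |- Ccv (fun n => (@?a n - @?b n)%C) _ => apply Ccv_minus
  | |- Ccv (fun n => (@?a n * @?b n)%C) _ => apply Ccv_mult
  | |- Ccv (fun n => (@?a n ^ _)%C) _ => apply Ccv_pow
  | |- Ccv (fun n => (- @?a n)%C) _ => apply Ccv_opp
  | H : Ccv ?u _ |- Ccv ?u _ => exact H
  end.

(** The expansion [f n = 1 + c / n + o(1 / n)]. *)
Definition FirstOrder (f : nat -> C) (c : C) : Prop :=
  Ccv (fun n => nC n * (f n - RtoC 1))%C c.

Lemma FirstOrder_ext_ev (f g : nat -> C) (c : C) :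
  eventually (fun n => f n = g n) -> FirstOrder f c -> FirstOrder g c.
Proof.
intros [N H]; apply Ccv_ext_ev; exists N; intros n Hn; now rewrite H.
Qed.

Lemma FirstOrder_lim (f : nat -> C) (c : C) : FirstOrder f c -> Ccv f (RtoC 1).
Proof.
intros H; replace (RtoC 1) with (RtoC 1 + RtoC 0 * c)%C by ring.
apply Ccv_ext_ev with (fun n => RtoC 1 + / nC n * (nC n * (f n - RtoC 1)))%C.
- exists 1%nat; intros n Hn; field; now apply nC_neq0.
- apply Ccv_plus; [apply Ccv_const | apply Ccv_mult; [apply Ccv_inv_nC | exact H]].
Qed.

Lemma FirstOrder_mult (f g : nat -> C) (b c : C) :
  FirstOrder f b -> FirstOrder g c -> FirstOrder (fun n => f n * g n)%C (b + c)%C.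
Proof.
intros Hf Hg; replace (b + c)%C with (b * RtoC 1 + c)%C by ring.
apply (Ccv_ext (fun n => (nC n * (f n - RtoC 1)) * g n + nC n * (g n - RtoC 1))%C);
  [intros n; ring|].
apply Ccv_plus; [apply Ccv_mult; [exact Hf | exact (FirstOrder_lim _ _ Hg)] | exact Hg].
Qed.

Lemma FirstOrder_inv (f : nat -> C) (c : C) :
  FirstOrder f c -> FirstOrder (fun n => / f n)%C (- c)%C.
Proof.
intros H; assert (L := FirstOrder_lim _ _ H).
destruct (Ccv_ev_neq0 _ _ L C1_nz) as [N HN].
replace (- c)%C with (- (c / RtoC 1))%C by (field; apply C1_nz).
apply Ccv_ext_ev with (fun n => - (nC n * (f n - RtoC 1) / f n))%C.
- exists N; intros n Hn; field; auto.
- apply Ccv_opp, Ccv_div; [apply C1_nz | exact H | exact L].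
Qed.

Lemma FirstOrder_pow (f : nat -> C) (c : C) (k : nat) :
  FirstOrder f c -> FirstOrder (fun n => f n ^ k)%C (RtoC (INR k) * c)%C.
Proof.
intros H; induction k as [|k IH].
- apply (Ccv_ext (fun _ => RtoC 0)); [intros n; simpl; ring|].
  simpl; rewrite Cmult_0_l; apply Ccv_const.
- rewrite S_INR, RtoC_plus; replace ((INR k + 1) * c)%C with (c + INR k * c)%C by ring.
  now apply (FirstOrder_mult f (fun n => f n ^ k)%C).
Qed.

Lemma FirstOrder_ratio (a b c : C) : a <> RtoC 0 ->
  FirstOrder (fun n => (a * nC n + b) / (a * nC n + c))%C ((b - c) / a)%C.
Proof.
intros Ha.
assert (L : Ccv (fun n => a + c * / nC n)%C a).
{ apply Ccv_eq with (a + c * RtoC 0)%C; [ring|].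
  apply Ccv_plus; [apply Ccv_const|].
  apply Ccv_mult; [apply Ccv_const | apply Ccv_inv_nC]. }
destruct (Ccv_ev_neq0 _ _ L Ha) as [N HN].
apply Ccv_ext_ev with (fun n => (b - c) / (a + c * / nC n))%C.
- exists (S N); intros n Hn.
  assert (Hn0 : nC n <> RtoC 0) by (apply nC_neq0; lia).
  assert (H1 := HN n ltac:(lia)).
  assert (H2 : (a * nC n + c)%C <> RtoC 0).
  { intros E; apply H1; replace (a + c * / nC n)%C with ((a * nC n + c) / nC n)%C
      by (field; exact Hn0); rewrite E; field; exact Hn0. }
  field; auto.
- apply Ccv_div; [exact Ha | apply Ccv_const | exact L].
Qed.

(** The square of the modulus is [1 + 2 Re c / n + o(1 / n)]. *)
Lemma FirstOrder_Cmod_le (f : nat -> C) (c : C) : FirstOrder f c -> Re c < 0 ->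
  exists eps, 0 < eps /\ eventually (fun n => Cmod (f n) <= 1 - eps / INR n).
Proof.
intros H Hc; set (eps := - Re c / 2).
set (g := fun n => (nC n * (f n - RtoC 1))%C) in *.
assert (Hinv := is_lim_seq_inv_INR).
assert (L1 : is_lim_seq (fun n => - 2 * Re (g n) - Cmod (g n) * Cmod (g n) * / INR n)
  (- 2 * Re c - Cmod c * Cmod c * 0)).
{ assert (M := Ccv_Cmod _ _ H); assert (Rl := Ccv_Re _ _ H).
  apply is_lim_seq_minus'.
  - apply is_lim_seq_mult'; [apply is_lim_seq_const | exact Rl].
  - apply is_lim_seq_mult'; [apply is_lim_seq_mult'; exact M | exact Hinv]. }
assert (L2 : is_lim_seq (fun n => 1 - eps * / INR n) (1 - eps * 0)).
{ apply is_lim_seq_minus'; [apply is_lim_seq_const|].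
  apply is_lim_seq_mult'; [apply is_lim_seq_const | exact Hinv]. }
destruct (is_lim_seq_ev_gt _ _ (2 * eps) L1) as [N1 H1]; [unfold eps; lra|].
destruct (is_lim_seq_ev_gt _ _ 0 L2) as [N2 H2]; [lra|].
exists eps; split; [unfold eps; lra|].
exists (S (N1 + N2)); intros n Hn.
specialize (H1 n ltac:(lia)); specialize (H2 n ltac:(lia)).
assert (Hn0 : 0 < INR n) by (apply lt_0_INR; lia).
assert (Hi : 0 < / INR n) by now apply Rinv_0_lt_compat.
assert (E : f n = (RtoC 1 + RtoC (/ INR n) * g n)%C).
{ unfold g, nC; rewrite RtoC_inv by lra; field.
  intros K; apply RtoC_inj in K; lra. }
apply Rsqr_incr_0_var; [|unfold Rdiv; lra].
unfold Rsqr, Rdiv; set (e := / INR n) in *.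
assert (Q1 : Cmod (f n) * Cmod (f n)
  = 1 + 2 * e * Re (g n) + e * e * (Cmod (g n) * Cmod (g n))).
{ replace (Cmod (f n) * Cmod (f n)) with (Cmod (f n) ^ 2) by ring.
  replace (Cmod (g n) * Cmod (g n)) with (Cmod (g n) ^ 2) by ring.
  rewrite E, !Cmod2_alt; destruct (g n) as [g1 g2]; simpl; ring. }
rewrite Q1; nra.
Qed.

(** The limit is the fixed point of the averaged equation [c z + d = 0]; the
distance to it obeys [harmonic_contraction]. *)
Lemma harmonic_contraction_C (z f g : nat -> C) (c d : C) :
  FirstOrder f c -> Re c < 0 -> Ccv g d ->
  eventually (fun n => z (S n) = f n * z n + g n / nC n)%C ->
  Ccv z (- d / c)%C.
Proof.
intros Hf Hc Hg [N HN].
assert (Hc0 : c <> RtoC 0) by (apply neq0_of_Re; lra).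
destruct (FirstOrder_Cmod_le _ _ Hf Hc) as [eps [He [M HM]]].
set (z0 := (- d / c)%C).
set (o := fun n => (nC n * (f n - RtoC 1) * z0 + g n)%C).
assert (Ho : Ccv o (RtoC 0)).
{ replace (RtoC 0) with (c * z0 + d)%C by (unfold z0; field; exact Hc0).
  apply Ccv_plus; [apply Ccv_mult; [exact Hf | apply Ccv_const] | exact Hg]. }
apply harmonic_contraction with (fun n => Cmod (o n)) eps; [exact He| | |].
- rewrite <- Cmod_0; now apply Ccv_Cmod.
- exists 0%nat; intros n _; apply Cmod_ge_0.
- exists (S (N + M)); intros n Hn.
  assert (Hn0 : nC n <> RtoC 0) by (apply nC_neq0; lia).
  rewrite HN by lia.
  replace (f n * z n + g n / nC n - z0)%C with (f n * (z n - z0) + o n / nC n)%C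
    by (unfold o; field; exact Hn0).
  eapply Rle_trans; [apply Cmod_triangle|].
  rewrite Cmod_mult, Cmod_div by exact Hn0.
  replace (Cmod (nC n)) with (INR n)
    by (unfold nC; rewrite Cmod_R, Rabs_pos_eq; auto using pos_INR).
  apply Rplus_le_compat_r, Rmult_le_compat_r; [apply Cmod_ge_0|].
  apply HM; lia.
Qed.

(** A form of [y n ~ n ^ c] without complex powers: only the ratio of consecutive
terms is compared with that of [n ^ c].  It ignores factors such as powers of
[ln n], but it still decides on decay and summability away from the critical exponents. *)
Definition PowerRate (y : nat -> C) (c : C) : Prop :=
  eventually (fun n => y n <> RtoC 0) /\ FirstOrder (fun n => y (S n) / y n)%C c.

Lemma PowerRate_ext_ev (y z : nat -> C) (c : C) :
  eventually (fun n => y n = z n) -> PowerRate y c -> PowerRate z c.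
Proof.
intros [N H] [[M HM] HF]; split.
- exists (N + M)%nat; intros n Hn; rewrite <- H by lia; apply HM; lia.
- apply FirstOrder_ext_ev with (2 := HF); exists N; intros n Hn; rewrite !H by lia; reflexivity.
Qed.

Lemma PowerRate_mult (y z : nat -> C) (b c : C) :
  PowerRate y b -> PowerRate z c -> PowerRate (fun n => y n * z n)%C (b + c)%C.
Proof.
intros [[N HN] Hy] [[M HM] Hz]; split.
- exists (N + M)%nat; intros n Hn; apply Cmult_neq_0; [apply HN | apply HM]; lia.
- apply FirstOrder_ext_ev with (2 := FirstOrder_mult _ _ _ _ Hy Hz).
  exists (N + M)%nat; intros n Hn; field; split; [apply HM | apply HN]; lia.
Qed.

Lemma Cinv_neq_0 (z : C) : z <> RtoC 0 -> (/ z)%C <> RtoC 0.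
Proof.
intros Hz E; apply C1_nz; rewrite <- (Cinv_l z Hz), E; ring.
Qed.

Lemma PowerRate_inv (y : nat -> C) (c : C) : PowerRate y c -> PowerRate (fun n => / y n)%C (- c)%C.
Proof.
intros [[N HN] Hy]; split.
- exists N; intros n Hn; apply Cinv_neq_0; auto.
- apply FirstOrder_ext_ev with (2 := FirstOrder_inv _ _ Hy).
  exists N; intros n Hn; field; split; apply HN; lia.
Qed.

Lemma PowerRate_div (y z : nat -> C) (b c : C) :
  PowerRate y b -> PowerRate z c -> PowerRate (fun n => y n / z n)%C (b - c)%C.
Proof. intros Hy Hz; apply PowerRate_mult; [|apply PowerRate_inv]; assumption. Qed.

Lemma PowerRate_scal (k : C) (y : nat -> C) (c : C) :
  k <> RtoC 0 -> PowerRate y c -> PowerRate (fun n => k * y n)%C c.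
Proof.
intros Hk [[N HN] Hy]; split.
- exists N; intros n Hn; apply Cmult_neq_0; auto.
- apply FirstOrder_ext_ev with (2 := Hy); exists N; intros n Hn; field; auto.
Qed.

Lemma PowerRate_nC : PowerRate nC (RtoC 1).
Proof.
split; [exists 1%nat; intros n Hn; now apply nC_neq0|].
apply Ccv_ext_ev with (fun _ => RtoC 1); [|apply Ccv_const].
exists 1%nat; intros n Hn; rewrite nC_S; field; now apply nC_neq0.
Qed.

Lemma PowerRate_S (y : nat -> C) (c : C) : PowerRate y c -> PowerRate (fun n => y (S n)) c.
Proof.
intros [[N HN] Hy]; split; [exists N; intros n Hn; apply HN; lia|].
replace c with (RtoC 1 * c)%C by ring.
assert (H1 := FirstOrder_lim _ _ (FirstOrder_inv _ _ (proj2 PowerRate_nC))).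
apply Ccv_ext_ev with (2 := Ccv_mult _ _ _ _ H1 (Ccv_incr_1 _ _ Hy)).
exists 1%nat; intros n Hn.
set (t := (y (S (S n)) / y (S n))%C); field; split; apply nC_neq0; lia.
Qed.

Lemma PowerRate_null (y : nat -> C) (c : C) : PowerRate y c -> Re c < 0 -> Ccv y (RtoC 0).
Proof.
intros [[N HN] Hy] Hc.
replace (RtoC 0) with (- RtoC 0 / c)%C
  by (field; apply neq0_of_Re; lra).
apply harmonic_contraction_C with (1 := Hy) (g := fun _ => RtoC 0);
  [exact Hc | apply Ccv_const |].
exists (S N); intros n Hn; field; split; [apply nC_neq0 | apply HN]; lia.
Qed.

(** The hypothesis says that [y] behaves like the integral of the power [n ^ c]. *)
Lemma PowerRate_of_increments (y e : nat -> C) (c : C) :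
  (RtoC 1 + c)%C <> RtoC 0 ->
  eventually (fun n => y (S n) - y n = e n)%C ->
  eventually (fun n => e n <> RtoC 0) ->
  Ccv (fun n => y n / (nC n * e n))%C (/ (RtoC 1 + c))%C ->
  PowerRate y (RtoC 1 + c)%C.
Proof.
intros Hc [N HN] [M HM] Hy.
destruct (Ccv_ev_neq0 _ _ Hy (Cinv_neq_0 _ Hc)) as [K HK].
assert (Hy0 : forall n, (K <= n)%nat -> y n <> RtoC 0).
{ intros n Hn E; apply (HK n Hn); rewrite E; unfold Cdiv; ring. }
split; [now exists K|].
apply Ccv_eq with (/ / (RtoC 1 + c))%C;
  [field; exact Hc|].
apply Ccv_ext_ev with (2 := Ccv_inv _ _ (Cinv_neq_0 _ Hc) Hy).
exists (S (N + M + K)); intros n Hn.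
assert (E : y (S n) = (y n + e n)%C) by (rewrite <- HN by lia; ring).
rewrite E; field.
repeat split; (apply nC_neq0 || apply HM || apply Hy0); lia.
Qed.

(** When the increments [e] are not summable, [y n / (n * e n)] satisfies a
contracting recursion whose fixed point is [1 / (1 + c)]. *)
Lemma PowerRate_sum (y e : nat -> C) (c : C) :
  PowerRate e c -> -1 < Re c -> eventually (fun n => y (S n) - y n = e n)%C ->
  PowerRate y (RtoC 1 + c)%C.
Proof.
intros He Hc HN.
assert (Hc0 : (RtoC 1 + c)%C <> RtoC 0).
{ apply neq0_of_Re; change (1 + Re c <> 0); lra. }
assert (Hv := PowerRate_inv _ _ (PowerRate_mult _ _ _ _ PowerRate_nC He)).
apply PowerRate_of_increments with e; [exact Hc0 | exact HN | apply He |].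
destruct HN as [N HN], He as [[M HM] _], Hv as [_ Hv].
replace (/ (1 + c))%C with (- RtoC 1 / - (1 + c))%C
  by (field; exact Hc0).
apply harmonic_contraction_C with (1 := Hv) (3 := FirstOrder_lim _ _ Hv);
  [change (- (1 + Re c) < 0); lra|].
exists (S (N + M)); intros n Hn.
assert (E : y (S n) = (y n + e n)%C) by (rewrite <- HN by lia; ring).
rewrite E; field.
repeat split; (apply nC_neq0 || apply HM); lia.
Qed.

(** When [Re c < -1] the quantity [n * |e n|] decreases fast enough to dominate, by
telescoping, the tail of the series of the [|e n|] (Raabe's test).  The same
telescoping applied to [y n - n * e n / (1 + c)], whose increments are
[o(|e n|)], locates the limit to the precision needed for the rate. *)
Lemma PowerRate_tail (y e : nat -> C) (c : C) :
  PowerRate e c -> Re c < -1 -> (forall n, y (S n) - y n = e n)%C ->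
  exists l, Ccv y l /\ PowerRate (fun n => y n - l)%C (RtoC 1 + c)%C.
Proof.
intros He Hc HN.
assert (Hc0 : (RtoC 1 + c)%C <> RtoC 0).
{ apply neq0_of_Re; change (1 + Re c <> 0); lra. }
set (v := fun n => (nC n * e n)%C).
assert (Hv : PowerRate v (RtoC 1 + c)%C) by (apply PowerRate_mult; [apply PowerRate_nC | exact He]).
assert (Hc1 : Re (RtoC 1 + c)%C < 0) by (change (1 + Re c < 0); lra).
assert (Hv0 := PowerRate_null _ _ Hv Hc1).
destruct (FirstOrder_Cmod_le _ _ (proj2 Hv) Hc1) as [eps [Heps [N2 H2]]].
destruct (proj1 Hv) as [N1 H1].
assert (Hdec : forall n, (S (N1 + N2) <= n)%nat ->
  Cmod (e n) <= (Cmod (v n) - Cmod (v (S n))) / eps).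
{ intros n Hn; specialize (H1 n ltac:(lia)); specialize (H2 n ltac:(lia)).
  rewrite Cmod_div in H2 by exact H1.
  assert (P1 : 0 < Cmod (v n)) by now apply Cmod_gt_0.
  apply Rle_div_l in H2; [|exact P1].
  assert (P2 : 0 < INR n) by (apply lt_0_INR; lia).
  assert (E : Cmod (v n) = INR n * Cmod (e n)).
  { unfold v, nC; rewrite Cmod_mult, Cmod_R, Rabs_pos_eq; lra. }
  apply Rle_div_r; [exact Heps|].
  replace (Cmod (e n) * eps) with (eps / INR n * Cmod (v n))
    by (rewrite E; field; lra).
  lra. }
(* Used below with [eta = 1] for [y] itself and with a small [eta] for its
   corrected version. *)
assert (Tel : forall (s : nat -> C) (eta : R) (N : nat), 0 <= eta ->
  (S (N1 + N2) <= N)%nat ->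
  (forall n, (N <= n)%nat -> Cmod (s (S n) - s n)%C <= eta * Cmod (e n)) ->
  forall n m, (N <= n <= m)%nat ->
    Cmod (s m - s n)%C <= eta / eps * Cmod (v n) - eta / eps * Cmod (v m)).
{ intros s eta N Heta HNN Hs n m Hnm; replace m with (n + (m - n))%nat by lia.
  induction (m - n)%nat as [|k IH].
  - rewrite Nat.add_0_r; replace (s n - s n)%C with (RtoC 0) by ring.
    rewrite Cmod_0; lra.
  - rewrite Nat.add_succ_r; set (j := (n + k)%nat) in *.
    assert (D := Hdec j ltac:(unfold j; lia)).
    assert (S1 := Hs j ltac:(unfold j; lia)).
    replace (s (S j) - s n)%C with ((s (S j) - s j) + (s j - s n))%C by ring.
    eapply Rle_trans; [apply Cmod_triangle|].
    assert (eta * Cmod (e j) <= eta * ((Cmod (v j) - Cmod (v (S j))) / eps))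
      by (apply Rmult_le_compat_l; assumption).
    assert (eta * ((Cmod (v j) - Cmod (v (S j))) / eps)
      = eta / eps * Cmod (v j) - eta / eps * Cmod (v (S j))) by (field; lra).
    lra. }
assert (Hscal : forall k, is_lim_seq (fun n => k * Cmod (v n)) 0).
{ intros k; replace 0 with (k * 0) by ring.
  apply is_lim_seq_mult'; [apply is_lim_seq_const|].
  rewrite <- Cmod_0; now apply Ccv_Cmod. }
destruct (Ccv_of_decrements y (fun n => 1 / eps * Cmod (v n)) (S (N1 + N2)))
  as [l Hl].
{ apply Tel; [lra | lia |].
  intros n Hn; rewrite HN; lra. }
{ apply Hscal. }
exists l; split; [exact Hl|].
apply PowerRate_of_increments with e; [exact Hc0 | | apply He |].
{ exists 0%nat; intros n _; rewrite <- HN; ring. }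
apply is_lim_seq_spec; intros delta; simpl.
assert (Hdelta := cond_pos delta).
set (s := fun n => (y n - v n / (RtoC 1 + c))%C).
assert (Hs : Ccv s l).
{ replace l with (l - RtoC 0 / (RtoC 1 + c))%C by (field; exact Hc0).
  apply Ccv_minus; [exact Hl|].
  apply Ccv_div; [exact Hc0 | exact Hv0 | apply Ccv_const]. }
set (o := fun n => (nC n * (v (S n) / v n - RtoC 1) / (RtoC 1 + c))%C).
assert (Ho : Ccv o (RtoC 1)).
{ replace (RtoC 1) with ((RtoC 1 + c) / (RtoC 1 + c))%C by (field; exact Hc0).
  apply Ccv_div; [exact Hc0 | exact (proj2 Hv) | apply Ccv_const]. }
set (eta := eps * delta / 2).
assert (Heta : 0 < eta) by (unfold eta; apply Rdiv_lt_0_compat; nra).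
apply is_lim_seq_ev_lt with (a := eta) in Ho; [|exact Heta].
destruct Ho as [N3 H3].
set (N := (S (N1 + N2) + N3)%nat).
assert (B := Tel s eta N (Rlt_le _ _ Heta) ltac:(unfold N; lia)).
exists N; intros n Hn.
assert (Hvn : v n <> RtoC 0) by (apply H1; unfold N in Hn; lia).
assert (B1 : Cmod (s n - l)%C <= eta / eps * Cmod (v n)).
{ apply Ccv_dist_le with (1 := Hs)
    (v := fun m => eta / eps * Cmod (v n) - eta / eps * Cmod (v m)).
  - replace (Finite (eta / eps * Cmod (v n)))
      with (Finite (eta / eps * Cmod (v n) - 0)) by (f_equal; ring).
    apply is_lim_seq_minus'; [apply is_lim_seq_const | apply Hscal].
  - exists n; intros m Hm; apply B; [|lia].
    intros j Hj; unfold N in *.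
    assert (E : (s (S j) - s j = e j * - (o j - RtoC 1))%C).
    { unfold s; replace (y (S j)) with (y j + e j)%C by (rewrite <- HN; ring).
      assert (Hj1 := H1 j ltac:(lia)).
      assert (Hj2 : nC j <> RtoC 0) by (apply nC_neq0; lia).
      replace (e j) with (v j / nC j)%C by (unfold v; field; exact Hj2).
      unfold o; field; auto. }
    rewrite E, Cmod_mult, Cmod_opp, Rmult_comm.
    apply Rmult_le_compat_r; [apply Cmod_ge_0 | apply Rlt_le, H3; lia]. }
rewrite Rminus_0_r, Rabs_pos_eq by apply Cmod_ge_0.
fold (v n).
replace ((y n - l) / v n - / (1 + c))%C with ((s n - l) / v n)%C
  by (unfold s; field; auto).
rewrite Cmod_div by exact Hvn.
assert (P1 : 0 < Cmod (v n)) by now apply Cmod_gt_0.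
apply Rlt_div_l; [exact P1|].
replace (eta / eps) with (delta / 2) in B1 by (unfold eta; field; lra).
nra.
Qed.

(** * The recurrence behind both continued fractions *)

(** These are [nu (2 * n + 1)] and [nu (2 * n)]; formally [coef_down n] is
[coef_up (- n)]. *)
Definition coef_up (n : nat) : C :=
  (RtoC 2 * (RtoC 3 * nC n + RtoC 2) ^ 3 / (RtoC 27 * (RtoC 2 * nC n + RtoC 1)))%C.

Definition coef_down (n : nat) : C :=
  (RtoC 2 * (RtoC 3 * nC n - RtoC 2) ^ 3 / (RtoC 27 * (RtoC 2 * nC n - RtoC 1)))%C.

Ltac affine_neq0 :=
  apply neq0_of_Re; unfold nC; simpl;
  match goal with |- context [INR ?n] => generalize (pos_INR n) | _ => idtac end;
  intros; lra.

Definition Solution (x : C) (y : nat -> C) : Prop := forall n,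
  (coef_up (S n) * (y (S (S n)) - y (S n)) - coef_down (S n) * (y (S n) - y n)
   = (x ^ 2 - RtoC 1) * y (S n))%C.

Lemma coef_up_neq0 (n : nat) : coef_up n <> RtoC 0.
Proof.
apply Cmult_neq_0; [apply Cmult_neq_0|apply Cinv_neq_0, Cmult_neq_0].
- affine_neq0.
- apply Cpow_nz; affine_neq0.
- affine_neq0.
- affine_neq0.
Qed.

Lemma coef_down_S (n : nat) : coef_down (S n)
  = (RtoC 2 * (RtoC 3 * nC n + RtoC 1) ^ 3 / (RtoC 27 * (RtoC 2 * nC n + RtoC 1)))%C.
Proof. unfold coef_down; rewrite nC_S; field; repeat split; affine_neq0. Qed.

Lemma coef_down_S_neq0 (n : nat) : coef_down (S n) <> RtoC 0.
Proof.
rewrite coef_down_S; apply Cmult_neq_0; [apply Cmult_neq_0|apply Cinv_neq_0, Cmult_neq_0].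
- affine_neq0.
- apply Cpow_nz; affine_neq0.
- affine_neq0.
- affine_neq0.
Qed.

Lemma Solution_step (x : C) (y : nat -> C) (n : nat) : Solution x y ->
  y (S (S n)) = (y (S n)
    + ((x ^ 2 - RtoC 1) * y (S n) + coef_down (S n) * (y (S n) - y n)) / coef_up (S n))%C.
Proof.
intros H; rewrite <- (H n); field; apply coef_up_neq0.
Qed.

Lemma Solution_unique (x : C) (y z : nat -> C) :
  Solution x y -> Solution x z -> y 0%nat = z 0%nat -> y 1%nat = z 1%nat ->
  forall n, y n = z n.
Proof.
intros Hy Hz H0 H1 n.
cut (y n = z n /\ y (S n) = z (S n)); [tauto|].
induction n as [|n [IH0 IH1]]; [tauto|]; split; [exact IH1|].
rewrite (Solution_step x y n Hy), (Solution_step x z n Hz); now rewrite IH0, IH1.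
Qed.

Lemma Solution_scal (x k : C) (y : nat -> C) : Solution x y -> Solution x (fun n => k * y n)%C.
Proof.
intros Hy n; replace ((x ^ 2 - 1) * (k * y (S n)))%C
  with (k * ((x ^ 2 - 1) * y (S n)))%C by ring.
rewrite <- Hy; ring.
Qed.

Fixpoint solution_pair (x y0 y1 : C) (n : nat) : C * C :=
  match n with
  | O => (y0, y1)
  | S m => let (u, v) := solution_pair x y0 y1 m in
    (v, (v + ((x ^ 2 - RtoC 1) * v + coef_down (S m) * (v - u)) / coef_up (S m))%C)
  end.

Lemma solution_pair_Solution (x y0 y1 : C) : Solution x (fun n => fst (solution_pair x y0 y1 n)).
Proof.
intros n; simpl.
destruct (solution_pair x y0 y1 n) as [u v]; simpl; field; apply coef_up_neq0.
Qed.

(** The values at [0] and [1] are those that make the solution even, respectively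
odd, under [n -> - n]: the recurrence at [n = 0], where both coefficients equal
[coef_up 0], then reads [2 * coef_up 0 * (y 1 - y 0) = (x ^ 2 - 1) * y 0] for an
even [y] and is void for an odd one. *)
Definition numer (x : C) (n : nat) : C :=
  fst (solution_pair x (RtoC 1) (RtoC 1 + (x ^ 2 - RtoC 1) / (RtoC 2 * coef_up 0))%C n).

Definition denom (x : C) (n : nat) : C := fst (solution_pair x (RtoC 0) (/ coef_up 0)%C n).

(** With [D n = a_n (y_(n+1) - y_n) + c_n (y_n - y_(n-1))] the recurrence gives
[D n = 2 a_n (y_(n+1) - y_n) - (x ^ 2 - 1) y_n], so the last summand is
[108 * n * D n].  As [D] reverses parity under [n -> - n], the operator preserves
it; this is why it maps [numer] and [denom] to multiples of themselves. *)
Definition ladder (x : C) (y : nat -> C) (n : nat) : C :=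
  (((RtoC 3 * x + RtoC 1) ^ 3 + RtoC 216 * (x + RtoC 1) * nC n ^ 2) * y n
   + RtoC 108 * nC n
     * (RtoC 2 * coef_up n * (y (S n) - y n) - (x ^ 2 - RtoC 1) * y n))%C.

(** Two steps of the recurrence express everything through [y n] and [y (S n)],
and a rational identity remains. *)
Lemma ladder_Solution (x : C) (y : nat -> C) :
  Solution x y -> Solution (x + RtoC 2)%C (ladder x y).
Proof.
intros H n; unfold ladder.
rewrite (Solution_step x y (S n) H), (Solution_step x y n H).
rewrite !coef_down_S; unfold coef_up; rewrite !nC_S.
generalize (y n) (y (S n)); intros a b.
field; repeat split; affine_neq0.
Qed.

Lemma numer_Solution (x : C) : Solution x (numer x).
Proof. apply solution_pair_Solution. Qed.

Lemma denom_Solution (x : C) : Solution x (denom x).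
Proof. apply solution_pair_Solution. Qed.

Lemma coef_up_0 : coef_up 0 = (RtoC 16 / RtoC 27)%C.
Proof. unfold coef_up, nC; simpl INR; field; repeat split; affine_neq0. Qed.

Lemma ladder_numer (x : C) (n : nat) :
  ladder x (numer x) n = ((RtoC 3 * x + RtoC 1) ^ 3 * numer (x + RtoC 2) n)%C.
Proof.
revert n; apply (Solution_unique (x + RtoC 2)%C).
- apply ladder_Solution, numer_Solution.
- apply Solution_scal, numer_Solution.
- unfold ladder, numer, nC; simpl; ring.
- unfold ladder; rewrite (Solution_step x _ 0 (numer_Solution x)), nC_S.
  rewrite coef_down_S; unfold numer; simpl fst.
  rewrite coef_up_0; unfold coef_up; rewrite nC_S; unfold nC; simpl INR.
  field; repeat split; affine_neq0.
Qed.

Lemma ladder_denom (x : C) (n : nat) :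
  ladder x (denom x) n = ((RtoC 3 * x + RtoC 5) ^ 3 * denom (x + RtoC 2) n)%C.
Proof.
revert n; apply (Solution_unique (x + RtoC 2)%C).
- apply ladder_Solution, denom_Solution.
- apply Solution_scal, denom_Solution.
- unfold ladder, denom, nC; simpl; ring.
- unfold ladder; rewrite (Solution_step x _ 0 (denom_Solution x)), nC_S.
  rewrite coef_down_S; unfold denom; simpl fst.
  rewrite coef_up_0; unfold coef_up; rewrite nC_S; unfold nC; simpl INR.
  field; repeat split; affine_neq0.
Qed.

Lemma Solution_opp (x : C) (y : nat -> C) : Solution (- x)%C y -> Solution x y.
Proof.
intros H n; rewrite (H n); ring.
Qed.

Lemma numer_opp (x : C) (n : nat) : numer (- x)%C n = numer x n.
Proof.
revert n; apply (Solution_unique x); [|apply numer_Solution | reflexivity |].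
- apply Solution_opp, numer_Solution.
- unfold numer; simpl; f_equal; f_equal; ring.
Qed.

Lemma denom_opp (x : C) (n : nat) : denom (- x)%C n = denom x n.
Proof.
revert n; apply (Solution_unique x); [|apply denom_Solution | reflexivity | reflexivity].
apply Solution_opp, denom_Solution.
Qed.

Lemma ladder_comb (x a b : C) (y z : nat -> C) (n : nat) :
  ladder x (fun n => a * y n + b * z n)%C n
  = (a * ladder x y n + b * ladder x z n)%C.
Proof. unfold ladder; ring. Qed.

(** The recurrence depends on [x ^ 2] only, so the ladder at [- (x + 2)] starts from
the solutions for [x + 2] and ends at those for [- x], that is, for [x]. *)
Lemma ladder_down_numer (x : C) (n : nat) :
  ladder (- (x + RtoC 2))%C (numer (x + RtoC 2)) n
  = (- (RtoC 3 * x + RtoC 5) ^ 3 * numer x n)%C.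
Proof.
assert (H := ladder_numer (- (x + RtoC 2))%C n); unfold ladder in *.
rewrite !numer_opp in H; rewrite H.
replace (- (x + RtoC 2) + RtoC 2)%C with (- x)%C by ring.
rewrite numer_opp; ring.
Qed.

Lemma ladder_down_denom (x : C) (n : nat) :
  ladder (- (x + RtoC 2))%C (denom (x + RtoC 2)) n
  = (- (RtoC 3 * x + RtoC 1) ^ 3 * denom x n)%C.
Proof.
assert (H := ladder_denom (- (x + RtoC 2))%C n); unfold ladder in *.
rewrite !denom_opp in H; rewrite H.
replace (- (x + RtoC 2) + RtoC 2)%C with (- x)%C by ring.
rewrite denom_opp; ring.
Qed.

(** * Recessive solutions *)

Definition casoratian (x : C) (n : nat) : C :=
  (numer x n * denom x (S n) - numer x (S n) * denom x n)%C.

Lemma casoratian_S (x : C) (n : nat) :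
  casoratian x (S n) = (coef_down (S n) / coef_up (S n) * casoratian x n)%C.
Proof.
unfold casoratian.
rewrite (Solution_step x _ n (numer_Solution x)), (Solution_step x _ n (denom_Solution x)).
field; apply coef_up_neq0.
Qed.

Lemma casoratian_neq0 (x : C) (n : nat) : casoratian x n <> RtoC 0.
Proof.
induction n as [|n IH].
- unfold casoratian, numer, denom; simpl.
  replace (_ - _)%C with (/ coef_up 0)%C by ring; apply Cinv_neq_0, coef_up_neq0.
- rewrite casoratian_S; apply Cmult_neq_0; [|exact IH].
  apply Cmult_neq_0; [apply coef_down_S_neq0 | apply Cinv_neq_0, coef_up_neq0].
Qed.

Lemma FirstOrder_down_up : FirstOrder (fun n => coef_down (S n) / coef_up (S n))%C (RtoC (-3)).
Proof.
apply Ccv_eq with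
  (RtoC (INR 3) * ((RtoC 1 - RtoC 5) / RtoC 3) + (RtoC 3 - RtoC 1) / RtoC 2)%C.
{ simpl INR; replace (1 + 1 + 1) with 3 by ring; field; split; affine_neq0. }
apply FirstOrder_ext_ev with (fun n =>
  ((RtoC 3 * nC n + RtoC 1) / (RtoC 3 * nC n + RtoC 5)) ^ 3
  * ((RtoC 2 * nC n + RtoC 3) / (RtoC 2 * nC n + RtoC 1)))%C.
- exists 0%nat; intros n _; rewrite coef_down_S; unfold coef_up; rewrite nC_S.
  field; repeat split; affine_neq0.
- apply FirstOrder_mult; [apply FirstOrder_pow|]; apply FirstOrder_ratio; affine_neq0.
Qed.

Lemma PowerRate_casoratian (x : C) : PowerRate (casoratian x) (RtoC (-3)).
Proof.
split; [exists 0%nat; intros n _; apply casoratian_neq0|].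
apply FirstOrder_ext_ev with (2 := FirstOrder_down_up).
exists 0%nat; intros n _; rewrite casoratian_S; field.
split; [apply coef_up_neq0 | apply casoratian_neq0].
Qed.

Definition pencil (x l : C) (n : nat) : C := (numer x n - l * denom x n)%C.

(** Substituting [n ^ s] into the recurrence leaves [(s + 1) ^ 2 = x ^ 2] in leading
order; the recessive exponent for [0 < Re x] is [- 1 - x]. *)
Definition Recessive (x l : C) : Prop := PowerRate (pencil x l) (RtoC (-1) - x)%C.

(** Reduction of order: the increments of this quotient are the Casoratian, of size
[n ^ (- 3)], divided by two consecutive values of the recessive solution, hence
of size [n ^ (2 x - 1)], and they are not summable. *)
Lemma Recessive_PowerRate_quotient (x l : C) : 0 < Re x -> Recessive x l ->
  PowerRate (fun n => denom x n / pencil x l n)%C (RtoC 2 * x)%C.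
Proof.
intros Hx Hl.
replace (RtoC 2 * x)%C
  with (RtoC 1 + (RtoC (-3) - ((RtoC (-1) - x) + (RtoC (-1) - x))))%C by ring.
apply PowerRate_sum with (fun n =>
  casoratian x n / (pencil x l n * pencil x l (S n)))%C.
- apply PowerRate_div; [apply PowerRate_casoratian|].
  apply PowerRate_mult; [exact Hl | apply PowerRate_S; exact Hl].
- simpl; unfold Re in Hx |- *; lra.
- destruct Hl as [[N HN] _]; exists N; intros n Hn.
  assert (H1 := HN n Hn); assert (H2 := HN (S n) ltac:(lia)).
  unfold pencil in *; unfold casoratian; field; auto.
Qed.

Lemma Recessive_PowerRate_denom (x l : C) :
  0 < Re x -> Recessive x l -> PowerRate (denom x) (x - RtoC 1)%C.
Proof.
intros Hx Hl.
replace (x - RtoC 1)%C with (RtoC 2 * x + (RtoC (-1) - x))%C by ring.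
apply PowerRate_ext_ev
  with (2 := PowerRate_mult _ _ _ _ (Recessive_PowerRate_quotient _ _ Hx Hl) Hl).
destruct Hl as [[N HN] _]; exists N; intros n Hn; field; auto.
Qed.

Lemma Recessive_pencil_denom (x l : C) : 0 < Re x -> Recessive x l ->
  Ccv (fun n => pencil x l n / denom x n)%C (RtoC 0).
Proof.
intros Hx Hl.
apply PowerRate_null with (RtoC (-1) - x - (x - RtoC 1))%C.
- apply PowerRate_div; [exact Hl | now apply Recessive_PowerRate_denom with l].
- simpl; unfold Re in Hx; lra.
Qed.

Lemma Recessive_cv (x l : C) :
  0 < Re x -> Recessive x l -> Ccv (fun n => numer x n / denom x n)%C l.
Proof.
intros Hx Hl; apply Ccv_eq with (RtoC 0 + l)%C; [ring|].
destruct (proj1 (Recessive_PowerRate_denom _ _ Hx Hl)) as [N HN].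
apply Ccv_ext_ev with (fun n => pencil x l n / denom x n + l)%C.
- exists N; intros n Hn; unfold pencil; field; auto.
- apply Ccv_plus; [now apply Recessive_pencil_denom | apply Ccv_const].
Qed.

Lemma Recessive_unique (x l m : C) : 0 < Re x -> Recessive x l -> Recessive x m -> l = m.
Proof.
intros Hx Hl Hm; eapply Ccv_unique; eapply Recessive_cv; eassumption.
Qed.

Lemma PowerRate_theta (y theta : nat -> C) (c s : C) : PowerRate y c -> FirstOrder theta (- s)%C ->
  Ccv (fun n => nC n * (y (S n) - theta n * y n) / y n)%C (c + s)%C.
Proof.
intros [[N HN] Hy] Ht; apply Ccv_eq with (c - - s)%C; [ring|].
apply Ccv_ext_ev with (2 := Ccv_minus _ _ _ _ Hy Ht).
exists N; intros n Hn; field; auto.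
Qed.

(** Both [denom (S n) - theta n * denom n] and the same expression in the recessive
solution are of the order of the solution divided by [n], the former because the
leading coefficient [x - 1 + s] does not vanish; so their quotient tends to [0]
with that of the solutions. *)
Lemma Recessive_cv_theta (x l : C) (theta : nat -> C) (s : C) : 0 < Re x -> Recessive x l ->
  FirstOrder theta (- s)%C -> (x - RtoC 1 + s)%C <> RtoC 0 ->
  eventually (fun n => denom x (S n) - theta n * denom x n <> RtoC 0)%C /\
  Ccv (fun n => (numer x (S n) - theta n * numer x n) / (denom x (S n) - theta n * denom x n))%C l.
Proof.
intros Hx Hl Ht Hs.
assert (Hq := Recessive_PowerRate_denom _ _ Hx Hl).
assert (Tq := PowerRate_theta _ _ _ _ Hq Ht).
assert (Tr := PowerRate_theta _ _ _ _ Hl Ht).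
destruct (Ccv_ev_neq0 _ _ Tq Hs) as [N1 H1].
destruct (proj1 Hq) as [N2 H2].
destruct (proj1 Hl) as [N3 H3].
assert (H4 : eventually (fun n => denom x (S n) - theta n * denom x n <> RtoC 0)%C).
{ exists N1; intros n Hn E; apply (H1 n Hn); rewrite E; unfold Cdiv; ring. }
split; [exact H4 | destruct H4 as [N4 H4]].
apply Ccv_eq with
  (RtoC 0 * ((RtoC (-1) - x + s) / (x - RtoC 1 + s)) + l)%C; [ring|].
apply Ccv_ext_ev with (2 := Ccv_plus _ _ _ _
  (Ccv_mult _ _ _ _ (Recessive_pencil_denom _ _ Hx Hl) (Ccv_div _ _ _ _ Hs Tr Tq))
  (Ccv_const l)).
exists (S (N1 + N2 + N3 + N4)); intros n Hn.
assert (K1 := H2 n ltac:(lia)); assert (K2 := H3 n ltac:(lia)).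
assert (K3 := H4 n ltac:(lia)); assert (K4 : nC n <> RtoC 0) by (apply nC_neq0; lia).
unfold pencil in *; field; auto.
Qed.

Lemma Ccv_up : Ccv (fun n => coef_up n / nC n ^ 2)%C (RtoC 1).
Proof.
apply Ccv_eq with (RtoC 2 * (RtoC 3 + RtoC 2 * RtoC 0) ^ 3
  / (RtoC 27 * (RtoC 2 + RtoC 0)))%C; [field; split; affine_neq0|].
apply Ccv_ext_ev with (fun n => RtoC 2 * (RtoC 3 + RtoC 2 * / nC n) ^ 3
  / (RtoC 27 * (RtoC 2 + / nC n)))%C.
- exists 1%nat; intros n Hn; unfold coef_up; assert (H := nC_neq0 n Hn).
  field; repeat split; try exact H; affine_neq0.
- assert (E := Ccv_inv_nC).
  apply Ccv_div; [apply Cmult_neq_0; affine_neq0 | |].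
  + apply Ccv_mult; [apply Ccv_const | apply Ccv_pow, Ccv_plus; [apply Ccv_const|]].
    apply Ccv_mult; [apply Ccv_const | exact E].
  + apply Ccv_mult; [|apply Ccv_plus]; try apply Ccv_const; exact E.
Qed.

(** Downwards the ladder multiplies the recessive solution [Y] for [x + 2] by
[- 432 (x + 2) n ^ 2] in leading order: there is no cancellation.  (On a
dominant solution the terms in [n ^ 2] would cancel.)  The upward ladder turns
the result [y] back into a multiple of [Y], of smaller order; since its terms of
order [n ^ 2] must cancel, this determines the exponent of [y]. *)
Lemma Recessive_step (x l : C) : 0 < Re x -> Recessive (x + RtoC 2)%C l ->
  Recessive x (((RtoC 3 * x + RtoC 1) / (RtoC 3 * x + RtoC 5)) ^ 3 * l)%C.
Proof.
intros Hx Hl; set (m := (_ * l)%C).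
assert (H1 : (RtoC 3 * x + RtoC 1)%C <> RtoC 0)
  by (apply neq0_of_Re; simpl; unfold Re in Hx; lra).
assert (H5 : (RtoC 3 * x + RtoC 5)%C <> RtoC 0)
  by (apply neq0_of_Re; simpl; unfold Re in Hx; lra).
set (Y := pencil (x + RtoC 2)%C l) in *.
set (k := (- (RtoC 3 * x + RtoC 5) ^ 3)%C).
assert (Hk : k <> RtoC 0).
{ unfold k; intros E; apply (Cpow_nz _ 3 H5).
  rewrite <- Copp_0, <- E; ring. }
set (y := fun n => (k * pencil x m n)%C).
assert (Ey : forall n, ladder (- (x + RtoC 2))%C Y n = y n).
{ intros n; unfold Y, pencil.
  transitivity (ladder (- (x + RtoC 2))%C (fun n => RtoC 1 * numer (x + RtoC 2) n
    + - l * denom (x + RtoC 2) n)%C n); [unfold ladder; ring|].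
  rewrite ladder_comb, ladder_down_numer, ladder_down_denom.
  unfold y, pencil, m, k; field; exact H5. }
assert (EY : forall n, ladder x y n = (k * (RtoC 3 * x + RtoC 1) ^ 3 * Y n)%C).
{ intros n; unfold y, pencil.
  transitivity (ladder x (fun n => k * numer x n + - (k * m) * denom x n)%C n);
    [unfold ladder; ring|].
  rewrite ladder_comb, ladder_numer, ladder_denom.
  unfold Y, pencil, m, k; field; exact H5. }
assert (Hn0 := Ccv_inv_nC); assert (Hup := Ccv_up).
destruct Hl as [[N HN] HY]; unfold FirstOrder in HY.
assert (Ht : Ccv (fun n => y n / Y n / nC n ^ 2)%C (- RtoC 432 * (x + RtoC 2))%C).
{ apply Ccv_eq with (
    (RtoC 3 * - (x + RtoC 2) + RtoC 1) ^ 3 * RtoC 0 * RtoC 0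
    + RtoC 216 * (- (x + RtoC 2) + RtoC 1)
    + RtoC 108 * (RtoC 2 * RtoC 1 * (RtoC (-1) - (x + RtoC 2))
        - (((- (x + RtoC 2)) ^ 2 - RtoC 1) * RtoC 0)))%C; [ring|].
  apply Ccv_ext_ev with (fun n =>
    (RtoC 3 * - (x + RtoC 2) + RtoC 1) ^ 3 * / nC n * / nC n
    + RtoC 216 * (- (x + RtoC 2) + RtoC 1)
    + RtoC 108 * (RtoC 2 * (coef_up n / nC n ^ 2) * (nC n * (Y (S n) / Y n - RtoC 1))
        - (((- (x + RtoC 2)) ^ 2 - RtoC 1) * / nC n)))%C.
  - exists (S N); intros n Hn; rewrite <- Ey; unfold ladder.
    assert (K1 := HN n ltac:(lia)).
    assert (K2 : nC n <> RtoC 0) by (apply nC_neq0; lia).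
    field; auto.
  - ccv. }
assert (Hlim : (- RtoC 432 * (x + RtoC 2))%C <> RtoC 0)
  by (apply neq0_of_Re; simpl; unfold Re in Hx; lra).
destruct (Ccv_ev_neq0 _ _ Ht Hlim) as [M HM].
assert (Hy0 : forall n, (M <= n)%nat -> y n <> RtoC 0).
{ intros n Hn E; apply (HM n Hn); rewrite E; unfold Cdiv; ring. }
assert (Ry : PowerRate y (RtoC (-1) - x)%C).
{ split; [now exists M|].
  apply Ccv_eq with (
    (k * (RtoC 3 * x + RtoC 1) ^ 3 * / (- RtoC 432 * (x + RtoC 2))
       * RtoC 0 * RtoC 0 * RtoC 0 * RtoC 0
     - (RtoC 3 * x + RtoC 1) ^ 3 * RtoC 0 * RtoC 0
     - RtoC 216 * (x + RtoC 1)
     + RtoC 108 * (x ^ 2 - RtoC 1) * RtoC 0) / (RtoC 216 * RtoC 1))%C.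
  { replace (- RtoC 432 * (x + RtoC 2))%C with (RtoC (-432) * (x + RtoC 2))%C
      by ring.
    field.
    intros E; apply Hlim; rewrite E; ring. }
  apply Ccv_ext_ev with (fun n =>
    (k * (RtoC 3 * x + RtoC 1) ^ 3 * / (y n / Y n / nC n ^ 2)
       * / nC n * / nC n * / nC n * / nC n
     - (RtoC 3 * x + RtoC 1) ^ 3 * / nC n * / nC n
     - RtoC 216 * (x + RtoC 1)
     + RtoC 108 * (x ^ 2 - RtoC 1) * / nC n) / (RtoC 216 * (coef_up n / nC n ^ 2)))%C.
  - exists (S (N + M)); intros n Hn.
    assert (K1 := HN n ltac:(lia)); assert (K3 := Hy0 n ltac:(lia)).
    assert (K2 : nC n <> RtoC 0) by (apply nC_neq0; lia).
    assert (K4 := coef_up_neq0 n).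
    assert (E : (k * (RtoC 3 * x + RtoC 1) ^ 3)%C = (ladder x y n / Y n)%C)
      by (rewrite EY; field; exact K1).
    rewrite E; unfold ladder; field; repeat split; auto; affine_neq0.
  - apply Ccv_div; [apply Cmult_neq_0; affine_neq0| |].
    + assert (Hti := Ccv_inv _ _ Hlim Ht).
      ccv.
    + apply Ccv_mult; [apply Ccv_const | exact Ccv_up]. }
apply PowerRate_ext_ev with (2 := PowerRate_scal (/ k)%C _ _ (Cinv_neq_0 _ Hk) Ry).
exists 0%nat; intros n _; unfold y; field; exact Hk.
Qed.

(** * Existence of the recessive combination in a right half-plane *)

Lemma coef_up_pos (n : nat) : exists r, 0 < r /\ coef_up n = RtoC r.
Proof.
exists (2 * (3 * INR n + 2) ^ 3 / (27 * (2 * INR n + 1))).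
assert (H := pos_INR n); split.
- apply Rdiv_lt_0_compat; [|lra].
  apply Rmult_lt_0_compat; [lra | apply pow_lt; lra].
- rewrite RtoC_div by lra; rewrite !RtoC_mult, RtoC_pow, !RtoC_plus, !RtoC_mult.
  reflexivity.
Qed.

Lemma coef_down_S_pos (n : nat) : exists r, 0 < r /\ coef_down (S n) = RtoC r.
Proof.
exists (2 * (3 * INR n + 1) ^ 3 / (27 * (2 * INR n + 1))).
assert (H := pos_INR n); split.
- apply Rdiv_lt_0_compat; [|lra].
  apply Rmult_lt_0_compat; [lra | apply pow_lt; lra].
- rewrite coef_down_S, RtoC_div by lra.
  rewrite !RtoC_mult, RtoC_pow, !RtoC_plus, !RtoC_mult; reflexivity.
Qed.

Lemma Re_Cinv (z : C) : Re (/ z)%C = Re z / Cmod z ^ 2.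
Proof. rewrite Cmod2_alt; destruct z as [a b]; reflexivity. Qed.

Lemma Cmod_1_plus_ge (h : C) : 0 <= Re h -> 1 <= Cmod (1 + h)%C.
Proof.
intros H; apply Rle_trans with (Re (1 + h)%C); [change (1 <= 1 + Re h); lra|].
eapply Rle_trans; [apply Rle_abs | apply re_le_Cmod].
Qed.

Lemma Re_h_over_1_plus_h (h : C) : 0 <= Re h -> 0 <= Re (h / (1 + h))%C.
Proof.
intros H; assert (H1 := Cmod_1_plus_ge h H).
replace (h / (1 + h))%C with (1 - / (1 + h))%C
  by (field; apply neq0_of_Re; change (1 + Re h <> 0); lra).
change (0 <= 1 - Re (/ (1 + h))%C); rewrite Re_Cinv.
assert (Re (1 + h)%C / Cmod (1 + h) ^ 2 <= 1); [|lra].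
apply Rle_div_l; [nra|].
assert (R1 : Re (1 + h)%C <= Cmod (1 + h))
  by (eapply Rle_trans; [apply Rle_abs | apply re_le_Cmod]).
nra.
Qed.

(** The increment ratio [h] obeys [a h' = (x ^ 2 - 1) + c * (h / (1 + h))] with
positive [a] and [c], and [h / (1 + h)] preserves the right half-plane. *)
Lemma denom_ratio_right_half_plane (x : C) (n : nat) : 0 <= Re (x ^ 2 - RtoC 1)%C ->
  denom x (S n) <> RtoC 0 /\ 0 <= Re (denom x (S (S n)) / denom x (S n) - RtoC 1)%C.
Proof.
intros Hw; induction n as [|n [IH0 IH1]].
- assert (H0 : denom x 1 <> RtoC 0) by (apply Cinv_neq_0, coef_up_neq0).
  split; [exact H0|].
  replace (denom x 2 / denom x 1 - RtoC 1)%C with ((x ^ 2 - RtoC 1 + coef_down 1) / coef_up 1)%C.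
  + destruct (coef_up_pos 1) as [r [Hr ->]], (coef_down_S_pos 0) as [s [Hs ->]].
    unfold Cdiv; rewrite <- RtoC_inv by lra.
    rewrite re_scal_r; apply Rmult_le_pos; [|apply Rlt_le, Rinv_0_lt_compat, Hr].
    change (0 <= Re (x ^ 2 - 1)%C + s); lra.
  + rewrite (Solution_step x _ 0 (denom_Solution x)).
    replace (denom x 0) with (RtoC 0) by reflexivity; field; split; [apply coef_up_neq0 | exact H0].
- set (h := (denom x (S (S n)) / denom x (S n) - RtoC 1)%C) in *.
  assert (H1h : (1 + h)%C <> RtoC 0)
    by (apply neq0_of_Re; change (1 + Re h <> 0); lra).
  assert (E : denom x (S (S n)) = (denom x (S n) * (1 + h))%C)
    by (unfold h; field; exact IH0).
  assert (H0 : denom x (S (S n)) <> RtoC 0) by (rewrite E; now apply Cmult_neq_0).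
  split; [exact H0|].
  replace (_ - RtoC 1)%C
    with ((x ^ 2 - RtoC 1 + coef_down (S (S n)) * (h / (1 + h))) / coef_up (S (S n)))%C.
  + destruct (coef_up_pos (S (S n))) as [r [Hr ->]], (coef_down_S_pos (S n)) as [s [Hs ->]].
    unfold Cdiv at 1; rewrite <- RtoC_inv by lra.
    rewrite re_scal_r; apply Rmult_le_pos; [|apply Rlt_le, Rinv_0_lt_compat, Hr].
    assert (K := Re_h_over_1_plus_h h IH1).
    change (0 <= Re (x ^ 2 - 1)%C + Re (s * (h / (1 + h)))%C).
    rewrite re_scal_l; nra.
  + rewrite (Solution_step x _ (S n) (denom_Solution x)), E; field.
    repeat split; auto using coef_up_neq0.
Qed.

(** With [g h = h / (1 + h)] one has [g h - g t = (h - t) / ((1 + h) (1 + t))], so in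
the right half-plane each step contracts the distance between [h] and the
approximate solution [t = (x - 1) / n] by [c / a = 1 - 3 / n + o(1 / n)]. *)
Lemma denom_dominant_right_half_plane (x : C) :
  0 < Re x -> 0 <= Re (x ^ 2 - RtoC 1)%C -> PowerRate (denom x) (x - RtoC 1)%C.
Proof.
intros Hx Hw.
assert (Hx1 : 1 <= Re x).
{ destruct x as [a b]; simpl in *; nra. }
assert (Hq := fun n => denom_ratio_right_half_plane x n Hw).
split; [exists 1%nat; intros [|n] Hn; [lia | apply Hq]|].
set (h := fun n => (denom x (S n) / denom x n - RtoC 1)%C).
set (K := fun n => (coef_down (S n) / coef_up (S n))%C).
assert (H1 : FirstOrder (fun n => nC (S n) / nC n * K n)%C (RtoC 1 + RtoC (-3))%C)
  by (apply FirstOrder_mult; [apply (proj2 PowerRate_nC) | apply FirstOrder_down_up]).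
destruct (FirstOrder_Cmod_le _ _ H1) as [eps [Heps [N HN]]]; [simpl; lra|].
(* [o n / n] is the amount by which [(x - 1) / n], scaled by the index, fails to
   satisfy the recursion; it is negligible because [x - 1] is the right exponent. *)
set (f := fun n => (K n * ((RtoC 1 * nC n + RtoC 1)
  / (RtoC 1 * nC n + (x - RtoC 1))))%C).
set (o := fun n => ((nC n / nC (S n)) * ((x ^ 2 - RtoC 1)
  / (coef_up (S n) / nC (S n) ^ 2)) + (x - RtoC 1) * (nC n * (f n - RtoC 1)))%C).
assert (Ho : Ccv o (RtoC 0)).
{ apply Ccv_eq with (RtoC 1 * ((x ^ 2 - RtoC 1) / RtoC 1)
    + (x - RtoC 1) * (RtoC (-3) + (RtoC 1 - (x - RtoC 1)) / RtoC 1))%C;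
    [field|].
  apply Ccv_plus; [apply Ccv_mult|apply Ccv_mult; [apply Ccv_const|]].
  - apply Ccv_ext_ev with (2 := FirstOrder_lim _ _ (FirstOrder_inv _ _ (proj2 PowerRate_nC))).
    exists 1%nat; intros n Hn; field; split; apply nC_neq0; lia.
  - apply Ccv_div; [apply C1_nz | apply Ccv_const | exact (Ccv_incr_1 _ _ Ccv_up)].
  - apply FirstOrder_mult; [apply FirstOrder_down_up | apply FirstOrder_ratio, C1_nz]. }
change (Ccv (fun n => nC n * h n)%C (x - RtoC 1)%C).
apply harmonic_contraction with (fun n => Cmod (o n)) eps; [exact Heps| | |].
- rewrite <- Cmod_0; now apply Ccv_Cmod.
- exists 0%nat; intros n _; apply Cmod_ge_0.
- exists (S N); intros n Hn.
  assert (Hn0 : nC n <> RtoC 0) by (apply nC_neq0; lia).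
  assert (HS0 : nC (S n) <> RtoC 0) by (apply nC_neq0; lia).
  destruct n as [|n']; [lia|]; destruct (Hq n') as [Q0 Qh]; destruct (Hq (S n')) as [Q1 _].
  set (n := S n') in *; fold (h n) in Qh.
  set (t := ((x - RtoC 1) / nC n)%C).
  assert (Ht : 0 <= Re t).
  { unfold t, Cdiv, nC; rewrite <- RtoC_inv by (apply not_0_INR; discriminate).
    rewrite re_scal_r; apply Rmult_le_pos; [change (0 <= Re x - 1); lra|].
    apply Rlt_le, Rinv_0_lt_compat, lt_0_INR; lia. }
  assert (M1 := Cmod_1_plus_ge _ Qh); assert (M2 := Cmod_1_plus_ge _ Ht).
  assert (P1 : (1 + h n)%C <> RtoC 0) by (apply Cmod_gt_0; lra).
  assert (P2 : (1 + t)%C <> RtoC 0) by (apply Cmod_gt_0; lra).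
  assert (Et : (nC n + (x - 1))%C = (nC n * (1 + t))%C)
    by (unfold t; field; exact Hn0).
  assert (P3 : (nC n + (x - 1))%C <> RtoC 0)
    by (rewrite Et; now apply Cmult_neq_0).
  assert (Eh : h (S n) = ((x ^ 2 - RtoC 1) / coef_up (S n) + K n * (h n / (1 + h n)))%C).
  { unfold h at 1; rewrite (Solution_step x _ n (denom_Solution x)).
    assert (E : denom x (S n) = (denom x n * (1 + h n))%C)
      by (unfold h; field; exact Q0).
    rewrite E; unfold K; field.
    repeat split; auto using coef_up_neq0. }
  assert (E : (nC (S n) * h (S n) - (x - 1)
    = (nC (S n) / nC n * K n) * ((nC n * h n - (x - 1)) / ((1 + h n) * (1 + t)))
      + o n / nC n)%C).
  { rewrite Eh; unfold o, f.
    replace (h n / (1 + h n))%C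
      with (t / (1 + t) + (h n - t) / ((1 + h n) * (1 + t)))%C by (field; auto).
    assert (Hxt : (x - RtoC 1)%C = (nC n * t)%C) by (unfold t; field; exact Hn0).
    replace (RtoC 1 * nC n + (x - RtoC 1))%C with (nC n * (1 + t))%C
      by (rewrite <- Et; ring).
    replace (RtoC 1 * nC n + RtoC 1)%C with (nC (S n)) by (rewrite nC_S; ring).
    rewrite !Hxt; field.
    repeat split; auto; apply coef_up_neq0. }
  rewrite E; eapply Rle_trans; [apply Cmod_triangle|].
  rewrite (Cmod_mult (nC (S n) / nC n * K n)), (Cmod_div _ ((1 + h n) * (1 + t))),
    (Cmod_mult (1 + h n)), (Cmod_div (o n)) by auto using Cmult_neq_0.
  replace (Cmod (nC n)) with (INR n)
    by (unfold nC; rewrite Cmod_R, Rabs_pos_eq; auto using pos_INR).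
  assert (M3 : 1 <= Cmod (1 + h n) * Cmod (1 + t)).
  { apply Rle_trans with (1 * 1); [lra|]; apply Rmult_le_compat; lra. }
  apply Rplus_le_compat_r, Rmult_le_compat; try apply Cmod_ge_0.
  + apply Rdiv_le_0_compat; [apply Cmod_ge_0 | lra].
  + apply HN; lia.
  + apply Rle_div_l; [lra|].
    assert (C0 := Cmod_ge_0 (nC n * h n - (x - 1))%C); nra.
Qed.

(** The increments of [numer / denom] have size [n ^ (- 1 - 2 x)], so the distance to
the limit has size [n ^ (- 2 x)]; multiplying by [denom] gives the recessive
exponent. *)
Lemma Recessive_exists_right_half_plane (x : C) :
  0 < Re x -> 0 <= Re (x ^ 2 - RtoC 1)%C -> exists l, Recessive x l.
Proof.
intros Hx Hw.
assert (Hq := denom_dominant_right_half_plane x Hx Hw).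
set (y := fun n => (numer x n / denom x n)%C).
assert (He : PowerRate (fun n => y (S n) - y n)%C
  (RtoC (-3) - ((x - RtoC 1) + (x - RtoC 1)))%C).
{ apply PowerRate_ext_ev with (fun n =>
    RtoC (-1) * (casoratian x n / (denom x n * denom x (S n))))%C.
  - destruct (proj1 Hq) as [N HN]; exists N; intros n Hn.
    unfold y, casoratian; field; split; apply HN; lia.
  - apply PowerRate_scal; [affine_neq0|].
    apply PowerRate_div; [apply PowerRate_casoratian|].
    apply PowerRate_mult; [|apply PowerRate_S]; exact Hq. }
destruct (PowerRate_tail y _ _ He) as [l [_ Hl]];
  [simpl; unfold Re in Hx; lra | reflexivity |].
exists l; unfold Recessive.
replace (RtoC (-1) - x)%C
  with (x - RtoC 1 + (RtoC 1 + (RtoC (-3) - ((x - RtoC 1) + (x - RtoC 1)))))%C by ring.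
apply PowerRate_ext_ev with (2 := PowerRate_mult _ _ _ _ Hq Hl).
destruct (proj1 Hq) as [N HN]; exists N; intros n Hn.
unfold y, pencil; field; auto.
Qed.

(** * Approximants as quotients of solutions *)

(** [X 0] and [X 1] stand for the numerators or denominators of order [-1] and [0],
so indices are shifted by one against the usual convention. *)
Definition cf_recurrence (a b X : nat -> C) : Prop := forall k,
  X (S (S k)) = (b (S k) * X (S k) + a (S k) * X k)%C.

(** The tail is the product of the matrices of its levels applied to [(0, 1)]; the
pair [(N, D)] are homogeneous coordinates of its value on the sphere, and a
solution of the recurrence is a row vector multiplied by the same matrices. *)
Lemma cf_tail_continuants (a b : nat -> C) (n k : nat) :
  (forall j, a (S j) <> RtoC 0) ->
  exists N D : C,
    (N <> RtoC 0 \/ D <> RtoC 0) /\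
    (D = RtoC 0 -> cf_tail a b (S k) n = None) /\
    (D <> RtoC 0 -> cf_tail a b (S k) n = Some (N / D)%C) /\
    (forall X, cf_recurrence a b X ->
       X (S k + n)%nat = (X k * N + X (S k) * D)%C).
Proof.
intros Ha; revert k; induction n as [|n IH]; intros k.
- exists (RtoC 0), (RtoC 1); repeat split.
  + right; apply C1_nz.
  + intros E; now elim C1_nz.
  + intros _; simpl; f_equal; field.
  + intros X _; rewrite Nat.add_0_r; ring.
- destruct (IH (S k)) as [N [D [HND [H0 [H1 HX]]]]].
  assert (Hak := Ha k).
  exists (a (S k) * D)%C, (b (S k) * D + N)%C; repeat split.
  + destruct (Ceq_dec D (RtoC 0)) as [->|HD].
    * right; rewrite Cmult_0_r, Cplus_0_l; tauto.
    * left; now apply Cmult_neq_0.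
  + intros E; destruct (Ceq_dec D (RtoC 0)) as [HD|HD].
    { exfalso; rewrite HD, Cmult_0_r, Cplus_0_l in E; tauto. }
    cbn [cf_tail]; rewrite H1 by exact HD; simpl.
    destruct Ceq_dec as [_|K]; [reflexivity|]; elim K.
    replace (b (S k) + N / D)%C with ((b (S k) * D + N) / D)%C by (field; exact HD).
    rewrite E; unfold Cdiv; ring.
  + intros E; cbn [cf_tail]; destruct (Ceq_dec D (RtoC 0)) as [HD|HD].
    { rewrite H0 by exact HD; simpl; f_equal; rewrite HD; unfold Cdiv; ring. }
    rewrite H1 by exact HD; simpl.
    assert (Q : (b (S k) + N / D)%C = ((b (S k) * D + N) / D)%C) by (field; exact HD).
    destruct Ceq_dec as [K|_].
    * elim E; replace (b (S k) * D + N)%C with ((b (S k) + N / D) * D)%C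
        by (field; exact HD); rewrite K; ring.
    * f_equal; rewrite Q; field; auto.
  + intros X HXr; replace (S k + S n)%nat with (S (S k) + n)%nat by lia.
    rewrite (HX X HXr), (HXr k); ring.
Qed.

Lemma cf_approximant_quotient (a b P Q : nat -> C) (b0 : C) (n : nat) :
  (forall j, a (S j) <> RtoC 0) ->
  cf_recurrence a b P -> cf_recurrence a b Q ->
  P 0%nat = RtoC 1 -> P 1%nat = b0 -> Q 0%nat = RtoC 0 -> Q 1%nat = RtoC 1 ->
  Q (S n) <> RtoC 0 ->
  cf_approximant b0 a b n = Some (P (S n) / Q (S n))%C.
Proof.
intros Ha HP HQ P0 P1 Q0 Q1 Hn.
destruct (cf_tail_continuants a b n 0 Ha) as [N [D [_ [_ [H1 HX]]]]].
assert (EP := HX P HP); assert (EQ := HX Q HQ).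
simpl in EP, EQ; rewrite P0, P1 in EP; rewrite Q0, Q1 in EQ.
assert (ED : D = Q (S n)) by (rewrite EQ; ring).
unfold cf_approximant; rewrite H1 by (rewrite ED; exact Hn); simpl.
f_equal; rewrite EP, ED; field; exact Hn.
Qed.

(** The product [nu_1 nu_3 ... nu_(2n-1)], the factor between the continuants of
either fraction and the solutions [numer] and [denom]. *)
Fixpoint gauge (n : nat) : C :=
  match n with O => RtoC 1 | S m => (gauge m * coef_up m)%C end.

Lemma gauge_neq0 (n : nat) : gauge n <> RtoC 0.
Proof.
induction n as [|n IH]; [apply C1_nz|].
apply Cmult_neq_0; [exact IH | apply coef_up_neq0].
Qed.

(** The continuants of a fraction whose odd-indexed partial numerators are
[theta n * coef_up n] and whose odd-indexed partial denominators are [1]. *)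
Definition interlace (theta y : nat -> C) (j : nat) : C :=
  let n := Nat.div2 j in
  if Nat.even j then (gauge n * y n)%C
  else (gauge (S n) * (y (S n) - theta n * y n))%C.

Lemma interlace_even (theta y : nat -> C) (n : nat) :
  interlace theta y (2 * n) = (gauge n * y n)%C.
Proof. unfold interlace; now rewrite even_double, Nat.div2_double. Qed.

Lemma interlace_odd (theta y : nat -> C) (n : nat) :
  interlace theta y (S (2 * n)) = (gauge (S n) * (y (S n) - theta n * y n))%C.
Proof.
unfold interlace.
rewrite Nat.even_succ, <- Nat.negb_even, even_double, Nat.div2_succ_double.
reflexivity.
Qed.

(** The parameter [e] is the common value of the partial denominators of even index.
When it vanishes the approximants of even order are left out of the limit, and
only then may the leading coefficient [x - 1 + s] vanish. *)
Lemma is_cf_of_recessive (x l b0 e s : C) (a b theta : nat -> C) :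
  0 < Re x -> Recessive x l ->
  (forall j, a (S j) <> RtoC 0) ->
  (forall n, b (S (2 * n)) = RtoC 1) -> (forall n, b (2 * n)%nat = e) ->
  (forall n, a (S (2 * n)) = theta n * coef_up n)%C ->
  (forall y, Solution x y -> forall n,
     coef_up (S n) * (y (S (S n)) - theta (S n) * y (S n))
     = e * y (S n) + a (2 * S n)%nat * (y (S n) - theta n * y n))%C ->
  b0 = (coef_up 0 * (numer x 1 - theta 0%nat))%C ->
  FirstOrder theta (- s)%C -> (x - RtoC 1 + s = RtoC 0 -> e = RtoC 0)%C ->
  is_cf b0 a b l.
Proof.
intros Hx Hl Ha Hbo Hbe Hao Hrec Hb0 Ht Hs.
assert (Hint : forall y, Solution x y -> cf_recurrence a b (interlace theta y)).
{ intros y Hy k; destruct (Nat.Even_or_Odd k) as [[n ->]|[n ->]].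
  - replace (S (S (2 * n))) with (2 * S n)%nat by lia.
    rewrite !interlace_even, interlace_odd, Hbo, Hao; simpl gauge; ring.
  - replace (2 * n + 1)%nat with (S (2 * n)) by lia.
    replace (S (S (2 * n))) with (2 * S n)%nat by lia.
    rewrite !interlace_odd, interlace_even, Hbe.
    change (gauge (S (S n))) with (gauge (S n) * coef_up (S n))%C.
    rewrite <- Cmult_assoc, (Hrec y Hy n); ring. }
assert (Happ : forall n, interlace theta (denom x) (S n) <> RtoC 0 ->
  cf_approximant b0 a b n
  = Some (interlace theta (numer x) (S n) / interlace theta (denom x) (S n))%C).
{ intros n Hn; apply cf_approximant_quotient; auto using numer_Solution, denom_Solution.
  - unfold interlace, numer; simpl; ring.
  - rewrite Hb0; unfold interlace; simpl Nat.div2; simpl Nat.even; cbv iota.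
    replace (numer x 0) with (RtoC 1) by reflexivity; simpl gauge; ring.
  - unfold interlace, denom; simpl; ring.
  - unfold interlace; simpl Nat.div2; simpl Nat.even; cbv iota.
    replace (denom x 0) with (RtoC 0) by reflexivity.
    replace (denom x 1) with (/ coef_up 0)%C by reflexivity.
    simpl gauge; field; apply coef_up_neq0. }
split.
{ intros N; exists (S (2 * N)); split; [lia | rewrite Hbo; apply C1_nz]. }
intros eps.
assert (Hodd := Recessive_cv x l Hx Hl).
destruct (proj1 (Recessive_PowerRate_denom x l Hx Hl)) as [N1 H1].
apply is_lim_seq_ev_lt with (a := eps) in Hodd; [|apply cond_pos].
destruct Hodd as [N2 H2].
assert (Heven : exists N, forall m, (N <= m)%nat -> e <> RtoC 0 ->
  (denom x (S m) - theta m * denom x m)%C <> RtoC 0 /\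
  Cmod ((numer x (S m) - theta m * numer x m) / (denom x (S m) - theta m * denom x m) - l)%C < eps).
{ destruct (Ceq_dec e (RtoC 0)) as [He|He]; [exists 0%nat; tauto|].
  destruct (Recessive_cv_theta x l theta s Hx Hl Ht) as [[M1 K1] K]; [tauto|].
  apply is_lim_seq_ev_lt with (a := eps) in K; [|apply cond_pos].
  destruct K as [M2 K2]; exists (M1 + M2)%nat; intros m Hm _.
  split; [apply K1 | apply K2]; lia. }
destruct Heven as [N3 H3].
exists (2 * S (N1 + N2 + N3))%nat; intros n Hn Hbn.
destruct (Nat.Even_or_Odd n) as [[m ->]|[m ->]].
- rewrite Hbe in Hbn; destruct (H3 m ltac:(lia) Hbn) as [K1 K2].
  assert (G := gauge_neq0 (S m)).
  eexists; split; [apply Happ|]; rewrite !interlace_odd.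
  + now apply Cmult_neq_0.
  + replace (gauge (S m) * (numer x (S m) - theta m * numer x m)
      / (gauge (S m) * (denom x (S m) - theta m * denom x m)))%C
      with ((numer x (S m) - theta m * numer x m) / (denom x (S m) - theta m * denom x m))%C
      by (field; auto); exact K2.
- assert (K1 := H1 (S m) ltac:(lia)); assert (K2 := H2 (S m) ltac:(lia)).
  assert (G := gauge_neq0 (S m)).
  eexists; split; [apply Happ|];
    replace (S (2 * m + 1)) with (2 * S m)%nat by lia; rewrite !interlace_even.
  + now apply Cmult_neq_0.
  + replace (gauge (S m) * numer x (S m) / (gauge (S m) * denom x (S m)))%C
      with (numer x (S m) / denom x (S m))%C by (field; auto); exact K2.
Qed.

Lemma nu_up (n : nat) : nu (S (2 * n)) = coef_up n.
Proof.
replace (S (2 * n)) with (2 * S n - 1)%nat by lia.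
rewrite nu_odd by lia; rewrite S_INR; assert (H := pos_INR n).
rewrite RtoC_div by lra; unfold coef_up, nC.
rewrite !RtoC_mult, RtoC_pow, !RtoC_minus, !RtoC_mult, !RtoC_plus.
field; repeat split; affine_neq0.
Qed.

Lemma nu_down (n : nat) : nu (2 * S n) = coef_down (S n).
Proof.
rewrite nu_even, coef_down_S, S_INR; assert (H := pos_INR n).
rewrite RtoC_div by lra; unfold nC.
rewrite !RtoC_mult, RtoC_pow, !RtoC_minus, !RtoC_mult, !RtoC_plus.
field; repeat split; affine_neq0.
Qed.

Lemma kappa_up (n : nat) : kappa (S (2 * n))
  = (((RtoC 3 * nC n + RtoC 1) / (RtoC 3 * nC n + RtoC 2)) ^ 2 * coef_up n)%C.
Proof.
replace (S (2 * n)) with (2 * S n - 1)%nat by lia.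
rewrite kappa_odd by lia; rewrite S_INR; assert (H := pos_INR n).
rewrite RtoC_div by lra; unfold coef_up, nC.
rewrite !RtoC_mult, RtoC_pow, !RtoC_minus, !RtoC_mult, !RtoC_plus.
field; repeat split; affine_neq0.
Qed.

Lemma kappa_down (n : nat) : kappa (2 * S n)
  = (RtoC 2 * (RtoC 3 * nC n + RtoC 1) * (RtoC 3 * nC n + RtoC 2) ^ 2
     / (RtoC 27 * (RtoC 2 * nC n + RtoC 1)))%C.
Proof.
rewrite kappa_even, S_INR; assert (H := pos_INR n).
rewrite RtoC_div by lra; unfold nC.
rewrite !RtoC_mult, RtoC_pow, !RtoC_minus, !RtoC_mult, !RtoC_plus.
field; repeat split; affine_neq0.
Qed.

Lemma even_S_double (n : nat) : Nat.even (S (2 * n)) = false.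
Proof. now rewrite Nat.even_succ, <- Nat.negb_even, even_double. Qed.

Lemma neq0_even_odd (a : nat -> C) :
  (forall n, a (S (2 * n)) <> RtoC 0) -> (forall n, a (2 * S n)%nat <> RtoC 0) ->
  forall j, a (S j) <> RtoC 0.
Proof.
intros Ho He j; destruct (Nat.Even_or_Odd j) as [[n ->]|[n ->]]; [apply Ho|].
replace (S (2 * n + 1)) with (2 * S n)%nat by lia; apply He.
Qed.

Lemma is_cf_nu (x l : C) : 0 < Re x -> Recessive x l ->
  is_cf ((x ^ 2 - RtoC 1) / RtoC 2)%C nu (d x) l.
Proof.
intros Hx Hl.
apply is_cf_of_recessive with x (x ^ 2 - RtoC 1)%C (RtoC 0) (fun _ => RtoC 1);
  try assumption.
- apply neq0_even_odd; intros n; [rewrite nu_up | rewrite nu_down];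
    auto using coef_up_neq0, coef_down_S_neq0.
- intros n; unfold d; now rewrite even_S_double.
- intros n; unfold d; now rewrite even_double.
- intros n; rewrite nu_up; ring.
- intros y Hy n; rewrite <- (Hy n), nu_down; ring.
- replace (numer x 1) with (RtoC 1 + (x ^ 2 - RtoC 1) / (RtoC 2 * coef_up 0))%C by reflexivity.
  field; apply coef_up_neq0.
- apply Ccv_ext with (fun _ => (- RtoC 0)%C); [intros n; ring | apply Ccv_const].
- intros E; replace x with ((x - 1 + 0) + 1)%C by ring; rewrite E; ring.
Qed.

Lemma is_cf_kappa (x l : C) : 0 < Re x -> Recessive x l ->
  is_cf ((x ^ 2 - RtoC (1 / 9)) / RtoC 2)%C kappa (c x) l.
Proof.
intros Hx Hl.
assert (E9 : RtoC (1 / 9) = (RtoC 1 / RtoC 9)%C) by (apply RtoC_div; lra).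
apply is_cf_of_recessive with x (x ^ 2 - RtoC (1 / 9))%C (RtoC 2 / RtoC 3)%C
  (fun n => ((RtoC 3 * nC n + RtoC 1) / (RtoC 3 * nC n + RtoC 2)) ^ 2)%C;
  try assumption.
- apply neq0_even_odd; intros n; [rewrite kappa_up | rewrite kappa_down];
    unfold Cdiv; repeat apply Cmult_neq_0 || apply Cpow_nz || apply Cinv_neq_0
      || apply coef_up_neq0; affine_neq0.
- intros n; unfold c; now rewrite even_S_double.
- intros n; unfold c; now rewrite even_double.
- intros n; apply kappa_up.
- intros y Hy n; rewrite (Solution_step x y n Hy), kappa_down, coef_down_S, E9.
  unfold coef_up; rewrite nC_S; field; repeat split; affine_neq0.
- replace (numer x 1) with (RtoC 1 + (x ^ 2 - RtoC 1) / (RtoC 2 * coef_up 0))%C by reflexivity.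
  rewrite coef_up_0, E9; unfold nC; simpl INR; field; repeat split; affine_neq0.
- apply Ccv_eq with (RtoC (INR 2) * ((RtoC 1 - RtoC 2) / RtoC 3))%C.
  + simpl INR; replace (1 + 1) with 2 by ring; field; affine_neq0.
  + apply (FirstOrder_pow (fun n => (RtoC 3 * nC n + RtoC 1) / (RtoC 3 * nC n + RtoC 2))%C).
    apply FirstOrder_ratio; affine_neq0.
- intros E; replace x with ((x - 1 + RtoC 2 / RtoC 3) + RtoC 1 / RtoC 3)%C
    by (field; affine_neq0).
  rewrite E, E9; field; split; affine_neq0.
Qed.

(** * The size of the limit far to the right *)

Lemma nu_pos (j : nat) : exists r, 0 < r /\ nu (S j) = RtoC r.
Proof.
destruct (Nat.Even_or_Odd j) as [[n ->]|[n ->]].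
- rewrite nu_up; apply coef_up_pos.
- replace (S (2 * n + 1)) with (2 * S n)%nat by lia; rewrite nu_down; apply coef_down_S_pos.
Qed.

(** Each level adds a number of positive real part and inverts, so no denominator
vanishes. *)
Lemma cf_tail_right_half_plane (x : C) (n k : nat) : 0 < Re (x ^ 2 - RtoC 1)%C ->
  exists z, cf_tail nu (d x) (S k) n = Some z /\ 0 <= Re z.
Proof.
intros Hw; revert k; induction n as [|n IH]; intros k.
- exists (RtoC 0); split; [reflexivity | apply Rle_refl].
- destruct (IH (S k)) as [z [Ez Hz]].
  assert (Hd : 0 < Re (d x (S k) + z)%C).
  { change (0 < Re (d x (S k)) + Re z).
    unfold d; destruct (Nat.even (S k)); [lra | change (0 < 1 + Re z); lra]. }
  exists (nu (S k) / (d x (S k) + z))%C; split.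
  + cbn [cf_tail]; rewrite Ez; simpl.
    destruct Ceq_dec as [K|_]; [|reflexivity].
    rewrite K in Hd; simpl in Hd; lra.
  + destruct (nu_pos k) as [r [Hr ->]].
    unfold Cdiv; rewrite re_scal_l, Re_Cinv.
    apply Rmult_le_pos; [lra|]; apply Rdiv_le_0_compat; [lra|].
    apply pow_lt, Cmod_gt_0, neq0_of_Re; lra.
Qed.

(** The whole fraction is [(x ^ 2 - 1) / 2 + nu_1 / (1 + z)] with [0 <= Re z] and
[nu_1 = 16 / 27]. *)
Lemma Recessive_far_right (x l : C) : 0 < Re x -> 0 < Re (x ^ 2 - RtoC 1)%C -> Recessive x l ->
  Cmod (l - (x ^ 2 - RtoC 1) / RtoC 2)%C <= 2.
Proof.
intros Hx Hw Hl.
destruct (is_cf_nu x l Hx Hl) as [_ H].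
destruct (H (mkposreal 1 Rlt_0_1)) as [N HN].
destruct (HN (S (2 * N))) as [v [Ev Hv]]; [lia | |].
{ unfold d; rewrite even_S_double; apply C1_nz. }
destruct (cf_tail_right_half_plane x (2 * N) 1 Hw) as [z [Ez Hz]].
assert (Hz1 := Cmod_1_plus_ge z Hz).
assert (Hz0 : (1 + z)%C <> RtoC 0) by (apply Cmod_gt_0; lra).
unfold cf_approximant in Ev; cbn [cf_tail] in Ev; rewrite Ez in Ev.
replace (d x 1) with (RtoC 1) in Ev by reflexivity.
cbn [sphere_add sphere_div] in Ev; destruct Ceq_dec as [K|_]; [contradiction|].
cbn [sphere_add] in Ev.
assert (Ev' : v = ((x ^ 2 - 1) / 2 + nu 1 / (1 + z))%C) by congruence.
replace (l - (x ^ 2 - 1) / 2)%C with (- (v - l) + nu 1 / (1 + z))%C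
  by (rewrite Ev'; ring).
eapply Rle_trans; [apply Cmod_triangle|]; rewrite Cmod_opp; simpl in Hv.
assert (Hnu : Cmod (nu 1 / (1 + z)) <= 1); [|lra].
replace (nu 1) with (RtoC (16 / 27))
  by (change 1%nat with (S (2 * 0)); rewrite nu_up, coef_up_0; apply RtoC_div; lra).
rewrite Cmod_div, Cmod_R, Rabs_pos_eq by (exact Hz0 || lra).
apply Rle_div_l; lra.
Qed.

(** * Euler's limit for the Gamma function *)

Lemma Cexp_plus (z w : C) : Cexp (z + w)%C = (Cexp z * Cexp w)%C.
Proof.
destruct z as [a b], w as [a' b']; unfold Cexp; simpl.
rewrite exp_plus, cos_plus, sin_plus.
apply injective_projections; simpl; ring.
Qed.

Lemma Cexp_RtoC (r : R) : Cexp (RtoC r) = RtoC (exp r).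
Proof.
unfold Cexp; simpl; rewrite cos_0, sin_0.
apply injective_projections; simpl; ring.
Qed.

Lemma Cexp_neq0 (z : C) : Cexp z <> RtoC 0.
Proof.
intros E; apply C1_nz; rewrite <- exp_0, <- Cexp_RtoC.
replace (RtoC 0) with (z + - z)%C by ring; rewrite Cexp_plus, E; ring.
Qed.

Lemma exp_le_3_of_le_1 (s : R) : s <= 1 -> exp s <= 3.
Proof.
intros Hs; apply Rle_trans with (exp 1); [|apply exp_le_3].
destruct (Req_dec s 1) as [->|]; [lra | apply Rlt_le, exp_increasing; lra].
Qed.

Lemma exp_second_order (s : R) : Rabs s <= 1 -> 0 <= exp s - 1 - s <= 6 * s ^ 2.
Proof.
intros Hs; split; [assert (H := exp_ineq1_le s); lra|].
destruct (Req_dec s 0) as [->|H0]; [rewrite exp_0; lra|].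
(* [exp s = 1 / exp (- s) <= 1 / (1 - s)] settles [s <= 1/2]. *)
assert (E1 := exp_ineq1_le (- s)).
assert (E2 : exp s * exp (- s) = 1) by (rewrite <- exp_plus, Rplus_opp_r; apply exp_0).
assert (Hp := exp_pos s).
apply Rabs_le_between in Hs.
destruct (Rle_lt_dec s (1 / 2)) as [L|L].
- assert (exp s * (1 - s) <= 1) by nra.
  apply Rmult_le_reg_r with (1 - s); nra.
- assert (H3 := exp_le_3_of_le_1 s ltac:(lra)); nra.
Qed.

Lemma Rabs_sin_le (t : R) : Rabs (sin t) <= Rabs t.
Proof.
assert (H : forall t, 0 < t -> Rabs (sin t) <= t).
{ intros r Hr; assert (K := sin_lt_x r Hr); assert (B := SIN_bound r).
  assert (L : - r <= sin r).
  { destruct (Rle_lt_dec r 1) as [L|L]; [|lra].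
    assert (0 < sin r) by (apply sin_gt_0; [lra | assert (P := PI2_1); lra]); lra. }
  apply Rabs_le; lra. }
destruct (Rtotal_order t 0) as [L|[->|L]].
- rewrite (Rabs_left t L), <- Rabs_Ropp, <- sin_neg; apply H; lra.
- rewrite sin_0; apply Rle_refl.
- rewrite (Rabs_right t) by lra; now apply H.
Qed.

Lemma cos_second_order (t : R) : 0 <= 1 - cos t <= t ^ 2 / 2.
Proof.
split; [assert (H := COS_bound t); lra|].
replace t with (2 * (t / 2)) at 1 by field; rewrite cos_2a_sin.
assert (H := Rabs_sin_le (t / 2)); apply Rsqr_le_abs_1 in H; unfold Rsqr in H; nra.
Qed.

(** By the mean value theorem [sin t - t = (cos s - 1) t]. *)
Lemma sin_second_order (t : R) : Rabs t <= 1 -> Rabs (sin t - t) <= t ^ 2 / 2.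
Proof.
assert (H : forall t, 0 < t <= 1 -> Rabs (sin t - t) <= t ^ 2 / 2).
{ intros r Hr; destruct (MVT_cor2 sin cos 0 r) as [c0 [E Hc]];
    [lra | intros; apply derivable_pt_lim_sin |].
  rewrite sin_0, !Rminus_0_r in E; rewrite E.
  assert (K := cos_second_order c0).
  replace (cos c0 * r - r) with (- ((1 - cos c0) * r)) by ring.
  rewrite Rabs_Ropp, Rabs_pos_eq by nra; nra. }
intros Ht; destruct (Rtotal_order t 0) as [L|[->|L]].
- rewrite Rabs_left in Ht by lra; specialize (H (- t) ltac:(lra)).
  rewrite sin_neg in H.
  replace (sin t - t) with (- (- sin t - - t)) by ring; rewrite Rabs_Ropp; nra.
- rewrite sin_0, Rminus_0_r, Rabs_R0; lra.
- rewrite Rabs_right in Ht by lra; apply H; lra.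
Qed.

Lemma Cexp_second_order (u : C) : Cmod u <= 1 ->
  Cmod (Cexp u - (1 + u))%C <= 10 * Cmod u ^ 2.
Proof.
intros Hu; assert (Hr := re_le_Cmod u); assert (Hi := Rabs_Im_le_Cmod u).
rewrite Cmod2_alt.
destruct u as [s t]; cbn [Re Im fst snd] in *.
assert (Es := exp_second_order s ltac:(lra)).
assert (Hs := sin_second_order t ltac:(lra)).
assert (Hc := cos_second_order t).
assert (H3 : exp s <= 3)
  by (apply exp_le_3_of_le_1; assert (K := Rle_abs s); lra).
assert (Hp := exp_pos s).
eapply Rle_trans; [apply Cmod_le_Re_Im|].
replace (Re (Cexp (s, t) - (1 + (s, t)))%C)
  with ((exp s - 1 - s) - exp s * (1 - cos t)) by (simpl; ring).
replace (Im (Cexp (s, t) - (1 + (s, t)))%C)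
  with (exp s * (sin t - t) + (exp s - 1) * t) by (simpl; ring).
assert (A1 : Rabs ((exp s - 1 - s) - exp s * (1 - cos t)) <= 6 * s ^ 2 + 3 * (t ^ 2 / 2)).
{ apply Rabs_le; nra. }
assert (A2 : Rabs (exp s * (sin t - t)) <= 3 * (t ^ 2 / 2)).
{ rewrite Rabs_mult, (Rabs_pos_eq (exp s)) by lra.
  apply Rmult_le_compat; try lra; apply Rabs_pos. }
assert (A3 : Rabs ((exp s - 1) * t) <= 7 / 2 * s ^ 2 + 7 / 2 * t ^ 2).
{ rewrite Rabs_mult.
  assert (Rabs (exp s - 1) <= 7 * Rabs s).
  { replace (exp s - 1) with (s + (exp s - 1 - s)) by ring.
    eapply Rle_trans; [apply Rabs_triang|].
    rewrite (Rabs_pos_eq (exp s - 1 - s)) by lra.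
    assert (s ^ 2 = Rabs s ^ 2) by (rewrite RPow_abs, Rabs_pos_eq; nra).
    assert (K := Rabs_pos s); nra. }
  assert (s ^ 2 = Rabs s ^ 2) by (rewrite RPow_abs, Rabs_pos_eq; nra).
  assert (t ^ 2 = Rabs t ^ 2) by (rewrite RPow_abs, Rabs_pos_eq; nra).
  assert (K1 := Rabs_pos s); assert (K2 := Rabs_pos t).
  assert (0 <= (Rabs s - Rabs t) ^ 2) by apply pow2_ge_0.
  nra. }
assert (A4 := Rabs_triang (exp s * (sin t - t)) ((exp s - 1) * t)).
lra.
Qed.

(** The partial products are bounded because [|u n| * exp (2 M / n)] decreases, and
then their increments are dominated by those of a multiple of [1 / n]. *)
Lemma Ccv_product (u r : nat -> C) (M : R) :
  0 <= M ->
  eventually (fun n => u (S n) = r n * u n)%C ->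
  eventually (fun n => Cmod (r n - 1)%C <= M / INR n ^ 2) ->
  exists l, Ccv u l.
Proof.
intros HM [N1 H1] [N2 H2].
set (N := S (N1 + N2)).
assert (Hpos : forall n, (N <= n)%nat -> 0 < INR n)
  by (intros n Hn; apply lt_0_INR; unfold N in Hn; lia).
assert (Htel : forall n, (N <= n)%nat ->
  M / INR n ^ 2 <= 2 * M / INR n - 2 * M / INR (S n)).
{ intros n Hn; specialize (Hpos n Hn); rewrite S_INR.
  assert (1 <= INR n) by (apply (le_INR 1); unfold N in Hn; lia).
  replace (2 * M / INR n - 2 * M / (INR n + 1))
    with (M / INR n ^ 2 * (2 * INR n / (INR n + 1))) by (field; lra).
  rewrite <- (Rmult_1_r (M / INR n ^ 2)) at 1; apply Rmult_le_compat_l.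
  - apply Rdiv_le_0_compat; [exact HM | now apply pow_lt].
  - apply Rle_div_r; lra. }
set (B := Cmod (u N) * exp (2 * M / INR N)).
assert (HB : forall n, (N <= n)%nat -> Cmod (u n) * exp (2 * M / INR n) <= B).
{ intros n Hn; induction Hn as [|n Hn IH]; [apply Rle_refl|].
  apply Rle_trans with (2 := IH).
  rewrite H1, Cmod_mult by (unfold N in Hn; lia).
  assert (D := H2 n ltac:(unfold N in Hn; lia)).
  assert (R1 : Cmod (r n) <= exp (M / INR n ^ 2)).
  { eapply Rle_trans; [|apply exp_ineq1_le].
    replace (r n) with ((r n - 1) + 1)%C by ring.
    eapply Rle_trans; [apply Cmod_triangle|]; rewrite Cmod_1; lra. }
  assert (T := Htel n Hn).
  apply Rle_trans with
    (exp (M / INR n ^ 2) * Cmod (u n) * exp (2 * M / INR (S n))).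
  - apply Rmult_le_compat_r; [apply Rlt_le, exp_pos|].
    apply Rmult_le_compat_r; [apply Cmod_ge_0 | exact R1].
  - rewrite (Rmult_comm (exp _) (Cmod _)), Rmult_assoc, <- exp_plus.
    apply Rmult_le_compat_l; [apply Cmod_ge_0|].
    destruct (Rle_lt_or_eq_dec _ _ T) as [L|L].
    + apply Rlt_le, exp_increasing; lra.
    + right; f_equal; lra. }
assert (HB2 : forall n, (N <= n)%nat -> Cmod (u n) <= B).
{ intros n Hn; apply Rle_trans with (2 := HB n Hn).
  rewrite <- (Rmult_1_r (Cmod (u n))) at 1; apply Rmult_le_compat_l; [apply Cmod_ge_0|].
  assert (K := exp_ineq1_le (2 * M / INR n)).
  assert (0 <= 2 * M / INR n) by (apply Rdiv_le_0_compat; [lra | auto]); lra. }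
assert (HB0 : 0 <= B)
  by (apply Rmult_le_pos; [apply Cmod_ge_0 | apply Rlt_le, exp_pos]).
apply Ccv_of_decrements with (fun n => B * (2 * M) * / INR n) N.
- intros n m [Hn Hnm]; induction Hnm as [|m Hm IH].
  + replace (u n - u n)%C with (RtoC 0) by ring; rewrite Cmod_0; lra.
  + assert (Hm' : (N <= m)%nat) by lia.
    replace (u (S m) - u n)%C with ((r m - 1) * u m + (u m - u n))%C
      by (rewrite H1 by (unfold N in Hm'; lia); ring).
    eapply Rle_trans; [apply Cmod_triangle|]; rewrite Cmod_mult.
    assert (D := H2 m ltac:(unfold N in Hm'; lia)).
    assert (T := Htel m Hm'); assert (Bm := HB2 m Hm').
    assert (Cmod (r m - 1)%C * Cmod (u m) <= (2 * M / INR m - 2 * M / INR (S m)) * B).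
    { apply Rmult_le_compat; try apply Cmod_ge_0; lra. }
    unfold Rdiv in *; nra.
- replace 0 with (B * (2 * M) * 0) by ring.
  apply is_lim_seq_mult'; [apply is_lim_seq_const | apply is_lim_seq_inv_INR].
Qed.

(** The reciprocals form a product of the same kind, so they converge as well. *)
Lemma Ccv_product_neq0 (u r : nat -> C) (M : R) :
  0 <= M ->
  eventually (fun n => u n <> RtoC 0) ->
  eventually (fun n => u (S n) = r n * u n)%C ->
  eventually (fun n => Cmod (r n - 1)%C <= M / INR n ^ 2) ->
  exists l, l <> RtoC 0 /\ Ccv u l.
Proof.
intros HM H0 H1 H2.
destruct (Ccv_product u r M HM H1 H2) as [l Hl].
destruct H0 as [N0 H0], H1 as [N1 H1], H2 as [N2 H2].
assert (Hinv : is_lim_seq (fun n => M * (/ INR n * / INR n)) 0).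
{ replace 0 with (M * (0 * 0)) by ring.
  assert (K := is_lim_seq_inv_INR).
  repeat apply is_lim_seq_mult'; try exact K; apply is_lim_seq_const. }
destruct (is_lim_seq_ev_lt _ _ (1 / 2) Hinv) as [N3 H3]; [lra|].
destruct (Ccv_product (fun n => / u n)%C (fun n => / r n)%C (2 * M)) as [m Hm].
- lra.
- exists (N0 + N1)%nat; intros n Hn.
  assert (K := H0 (S n) ltac:(lia)); rewrite H1 in K |- * by lia.
  assert (K' := H0 n ltac:(lia)).
  assert (r n <> RtoC 0) by (intros E; apply K; rewrite E; ring).
  field; auto.
- exists (S (N2 + N3)); intros n Hn.
  specialize (H2 n ltac:(lia)); specialize (H3 n ltac:(lia)).
  assert (Hn0 : 0 < INR n) by (apply lt_0_INR; lia).
  replace (M * (/ INR n * / INR n)) with (M / INR n ^ 2) in H3 by (field; lra).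
  assert (Hr : 1 / 2 <= Cmod (r n)).
  { assert (K := Cmod_triangle (r n) (- (r n - 1))%C).
    replace (r n + - (r n - 1))%C with (RtoC 1) in K by ring.
    rewrite Cmod_opp, Cmod_1 in K; lra. }
  assert (Hr0 : r n <> RtoC 0) by (apply Cmod_gt_0; lra).
  replace (/ r n - 1)%C with (- (r n - 1) / r n)%C by (field; exact Hr0).
  rewrite Cmod_div, Cmod_opp by exact Hr0.
  apply Rle_div_l; [lra|].
  replace (2 * M / INR n ^ 2) with (2 * (M / INR n ^ 2)) by (field; lra).
  assert (K := Cmod_ge_0 (r n - 1)%C); nra.
- exists l; split; [|exact Hl]; intros E.
  apply C1_nz; transitivity (l * m)%C; [|rewrite E; ring].
  apply Ccv_unique with (fun n => u n * / u n)%C; [|now apply Ccv_mult].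
  apply Ccv_ext_ev with (fun _ => RtoC 1); [|apply Ccv_const].
  exists N0; intros n Hn; field; auto.
Qed.

Definition euler_seq (z : C) (k : nat) : C :=
  (RtoC (INR (fact k)) * Rcpow (INR k) (z - RtoC 1) / Cpoch z k)%C.

Lemma Cpoch_neq0 (z : C) (k : nat) : 0 < Re z -> Cpoch z k <> RtoC 0.
Proof.
intros Hz; induction k as [|k IH]; [apply C1_nz|].
apply Cmult_neq_0; [exact IH | apply neq0_of_Re].
change (Re z + INR k <> 0); assert (H := pos_INR k); lra.
Qed.

Lemma ln_succ_bounds (k : nat) : (1 <= k)%nat ->
  0 <= ln (INR (S k)) - ln (INR k) <= / INR k /\
  Rabs (ln (INR (S k)) - ln (INR k) - / INR k) <= / INR k ^ 2.
Proof.
intros Hk; assert (H : 0 < INR k) by (apply lt_0_INR; lia).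
assert (Hk1 : 0 < INR (S k)) by (apply lt_0_INR; lia).
assert (L1 : ln (INR (S k)) - ln (INR k) <= / INR k).
{ assert (E : INR (S k) = INR k * (1 + / INR k)) by (rewrite S_INR; field; lra).
  assert (Hi := Rinv_0_lt_compat _ H).
  rewrite E, ln_mult by lra.
  assert (K := ln_le (1 + / INR k) _ ltac:(lra) (exp_ineq1_le (/ INR k))).
  rewrite ln_exp in K; lra. }
assert (L2 : / INR (S k) <= ln (INR (S k)) - ln (INR k)).
{ assert (Hi : 0 < 1 - / INR (S k)).
  { rewrite S_INR; replace (1 - / (INR k + 1)) with (INR k / (INR k + 1)) by (field; lra).
    apply Rdiv_lt_0_compat; lra. }
  assert (E : INR k = INR (S k) * (1 - / INR (S k))) by (rewrite S_INR; field; lra).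
  assert (El : ln (INR k) = ln (INR (S k)) + ln (1 - / INR (S k)))
    by (rewrite <- ln_mult by lra; now rewrite <- E).
  rewrite El.
  assert (K := ln_le (1 + - / INR (S k)) _ Hi (exp_ineq1_le (- / INR (S k)))).
  rewrite ln_exp in K; change (ln (1 - / INR (S k)) <= - / INR (S k)) in K; lra. }
assert (Hs := Rinv_0_lt_compat _ Hk1).
split; [lra|].
assert (D : / INR k - / INR (S k) <= / INR k ^ 2).
{ rewrite S_INR; replace (/ INR k - / (INR k + 1)) with (/ (INR k * (INR k + 1)))
    by (field; lra).
  apply Rinv_le_contravar; nra. }
apply Rabs_le; assert (0 < / INR k ^ 2) by (apply Rinv_0_lt_compat, pow_lt, H); lra.
Qed.

(** The ratio of consecutive terms is [(1 + 1/k) ^ (z-1) * (k+1) / (k+z)], in which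
the terms of order [1 / k] cancel. *)
Lemma euler_cv (z : C) : 0 < Re z -> exists g, g <> RtoC 0 /\ Ccv (euler_seq z) g.
Proof.
intros Hz; set (c0 := (z - 1)%C).
set (delta := fun k => ln (INR (S k)) - ln (INR k)).
set (r := fun k => (Cexp (c0 * RtoC (delta k)) * (nC (S k) / (nC k + z)))%C).
assert (Hkz : forall k, (nC k + z)%C <> RtoC 0).
{ intros k; apply neq0_of_Re; change (INR k + Re z <> 0).
  assert (H := pos_INR k); lra. }
set (a := Cmod c0); assert (Ha : 0 <= a) by apply Cmod_ge_0.
set (b := Cmod z); assert (Hb : 0 <= b) by apply Cmod_ge_0.
apply Ccv_product_neq0 with r (a + a * b + 10 * a ^ 2 * (1 + a) + a ^ 2).
- nra.
- exists 0%nat; intros k _; unfold euler_seq, Rcpow.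
  apply Cmult_neq_0; [apply Cmult_neq_0|apply Cinv_neq_0; now apply Cpoch_neq0].
  + intros E; apply RtoC_inj in E; now apply (INR_fact_neq_0 k).
  + apply Cexp_neq0.
- exists 1%nat; intros k Hk; unfold euler_seq, r, Rcpow; simpl Cpoch; fold c0.
  replace (c0 * ln (INR (S k)))%C with (c0 * delta k + c0 * ln (INR k))%C
    by (unfold delta; rewrite RtoC_minus; ring).
  rewrite Cexp_plus, fact_simpl, mult_INR, RtoC_mult; fold (nC (S k)) (nC k).
  assert (P := Cpoch_neq0 z k Hz); assert (K := Hkz k).
  field; auto.
- destruct (nfloor_ex a Ha) as [N [_ HN]].
  exists (S N); intros k Hk.
  assert (Hk0 : 0 < INR k) by (apply lt_0_INR; lia).
  assert (Hak : a <= INR k).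
  { apply Rlt_le; eapply Rlt_le_trans; [exact HN|].
    rewrite <- S_INR; apply le_INR; exact Hk. }
  destruct (ln_succ_bounds k ltac:(lia)) as [D1 D2]; fold (delta k) in D1, D2.
  set (e := / INR k) in *.
  assert (He : 0 < e) by now apply Rinv_0_lt_compat.
  assert (Eke : INR k * e = 1) by (unfold e; field; lra).
  assert (Ee2 : / INR k ^ 2 = e ^ 2) by (unfold e; field; lra).
  rewrite Ee2 in D2.
  set (u := (c0 * RtoC (delta k))%C).
  assert (Hu : Cmod u <= a * e).
  { unfold u; rewrite Cmod_mult, Cmod_R, Rabs_pos_eq by lra.
    apply Rmult_le_compat_l; [exact Ha | lra]. }
  assert (Hu1 : Cmod u <= 1) by nra.
  assert (HE := Cexp_second_order u Hu1).
  set (E := (Cexp u - (1 + u))%C) in *.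
  assert (HE2 : Cmod E <= 10 * a ^ 2 * e ^ 2).
  { eapply Rle_trans; [exact HE|]; assert (K := Cmod_ge_0 u); nra. }
  assert (Hw : INR k <= Cmod (nC k + z)%C).
  { apply Rle_trans with (Re (nC k + z)%C).
    - change (INR k <= INR k + Re z); lra.
    - eapply Rle_trans; [apply Rle_abs | apply re_le_Cmod]. }
  set (v := (/ (nC k + z))%C).
  assert (Hv : Cmod v <= e).
  { unfold v; rewrite Cmod_inv by apply Hkz; apply Rinv_le_contravar; assumption. }
  assert (Hnk : nC k <> RtoC 0) by (apply nC_neq0; lia).
  (* [v] is [1 / (k + z)] and [E] the remainder of the exponential; each of the
     four summands is [O(1 / k ^ 2)]. *)
  assert (Er : (r k - 1 = c0 * RtoC (delta k - e) + (c0 * z) * (RtoC e * v)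
    + E * (1 + - (c0 * v)) + - (c0 * u * v))%C).
  { unfold r; fold u; replace (Cexp u) with (1 + u + E)%C by (unfold E; ring).
    rewrite nC_S; unfold v, e.
    rewrite RtoC_minus, RtoC_inv by lra; fold (nC k).
    replace (c0 * (delta k - / nC k))%C with (u - c0 / nC k)%C
      by (unfold u; field; exact Hnk).
    replace (nC k + 1)%C with (nC k + z - c0)%C by (unfold c0; ring).
    field; auto. }
  rewrite Er.
  replace ((a + a * b + 10 * a ^ 2 * (1 + a) + a ^ 2) / INR k ^ 2)
    with (a * e ^ 2 + a * b * e ^ 2 + 10 * a ^ 2 * e ^ 2 * (1 + a) + a ^ 2 * e ^ 2)
    by (unfold e; field; lra).
  eapply Rle_trans; [apply Cmod_triangle|]; apply Rplus_le_compat;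
    [eapply Rle_trans; [apply Cmod_triangle|]; apply Rplus_le_compat;
      [eapply Rle_trans; [apply Cmod_triangle|]; apply Rplus_le_compat|]|].
  + rewrite Cmod_mult, Cmod_R; fold a; apply Rmult_le_compat_l; lra.
  + rewrite !Cmod_mult, Cmod_R, Rabs_pos_eq by lra; fold a b.
    apply Rmult_le_compat_l; [nra|].
    replace (e ^ 2) with (e * e) by ring; apply Rmult_le_compat_l; lra.
  + rewrite Cmod_mult; apply Rmult_le_compat; try apply Cmod_ge_0; [exact HE2|].
    eapply Rle_trans; [apply Cmod_triangle|].
    rewrite Cmod_1, Cmod_opp, Cmod_mult; fold a.
    assert (e <= 1).
    { unfold e; rewrite <- Rinv_1; apply Rinv_le_contravar; [lra|].
      apply (le_INR 1); lia. }
    assert (K := Cmod_ge_0 v); nra.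
  + rewrite Cmod_opp, !Cmod_mult; fold a.
    replace (a ^ 2 * e ^ 2) with (a * (a * e) * e) by ring.
    apply Rmult_le_compat; try apply Cmod_ge_0; [|apply Rmult_le_compat_l|]; auto.
    apply Rmult_le_pos; [exact Ha | apply Cmod_ge_0].
Qed.

(** * The value of the limit *)

(** The factorials cancel, and [k ^ (3 (a - b)) = k ^ (- 2)]. *)
Lemma euler_quotient (a : C) (k : nat) : (1 <= k)%nat -> 0 < Re a ->
  let b := (a + RtoC (2 / 3))%C in
  ((euler_seq a k / euler_seq b k) ^ 3 = (Cpoch b k / Cpoch a k) ^ 3 / nC k ^ 2)%C.
Proof.
intros Hk Ha b; unfold euler_seq.
assert (Hb : 0 < Re b) by (change (0 < Re a + 2 / 3); lra).
assert (Pa := Cpoch_neq0 a k Ha); assert (Pb := Cpoch_neq0 b k Hb).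
assert (F : RtoC (INR (fact k)) <> RtoC 0)
  by (intros E; apply RtoC_inj in E; now apply (INR_fact_neq_0 k)).
assert (Hk0 : 0 < INR k) by (apply lt_0_INR; lia).
assert (Hn : nC k <> RtoC 0) by now apply nC_neq0.
set (R1 := Rcpow (INR k) (a - RtoC 1)).
set (R2 := Rcpow (INR k) (b - RtoC 1)).
assert (H2 : R2 <> RtoC 0) by apply Cexp_neq0.
assert (E : (R2 ^ 3 = R1 ^ 3 * nC k ^ 2)%C).
{ replace (nC k ^ 2)%C with (Cexp (RtoC (2 * ln (INR k)))).
  - unfold R1, R2, Rcpow, b; simpl Cpow; rewrite !Cmult_1_r, <- !Cexp_plus.
    f_equal; rewrite RtoC_mult, RtoC_div by lra; field; affine_neq0.
  - rewrite Cexp_RtoC; replace (2 * ln (INR k)) with (ln (INR k) + ln (INR k)) by ring.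
    rewrite exp_plus, exp_ln by exact Hk0; rewrite RtoC_mult; unfold nC; ring. }
transitivity ((Cpoch b k / Cpoch a k) ^ 3 * (R1 ^ 3 / R2 ^ 3))%C.
- field; auto.
- rewrite E; field; repeat split; auto; apply Cexp_neq0.
Qed.

Lemma Cpoch_ratio_step (x : C) (k : nat) : 0 < Re x ->
  ((RtoC 3 * (x + RtoC (2 * INR k)) + RtoC 1) / (RtoC 3 * (x + RtoC (2 * INR k)) + RtoC 5)
   = (RtoC (1 / 2) * (x + RtoC (1 / 3)) + RtoC (INR k))
     / (RtoC (1 / 2) * (x + RtoC (5 / 3)) + RtoC (INR k)))%C.
Proof.
intros Hx; rewrite !RtoC_div, RtoC_mult by lra.
assert (H := pos_INR k).
field; repeat split; try affine_neq0.
all: apply neq0_of_Re; simpl; unfold Re in Hx; lra.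
Qed.

Lemma Recessive_shift (x l : C) (k : nat) : 0 < Re x ->
  Recessive (x + RtoC (2 * INR k))%C l ->
  Recessive x ((Cpoch (RtoC (1 / 2) * (x + RtoC (1 / 3))) k
          / Cpoch (RtoC (1 / 2) * (x + RtoC (5 / 3))) k) ^ 3 * l)%C.
Proof.
intros Hx; revert l; induction k as [|k IH]; intros l Hl.
- simpl in Hl; rewrite Rmult_0_r, Cplus_0_r in Hl; simpl Cpoch.
  replace (_ * l)%C with l by (field; apply C1_nz); exact Hl.
- assert (Hk := pos_INR k).
  replace (x + RtoC (2 * INR (S k)))%C with (x + RtoC (2 * INR k) + RtoC 2)%C in Hl
    by (rewrite S_INR, !RtoC_mult, RtoC_plus; ring).
  apply Recessive_step in Hl; [|simpl; unfold Re in Hx; lra].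
  apply IH in Hl; rewrite Cpoch_ratio_step in Hl by exact Hx.
  simpl Cpoch; revert Hl; match goal with |- Recessive x ?u -> Recessive x ?v =>
    replace u with v; [tauto|] end.
  assert (Hb : 0 < Re (RtoC (1 / 2) * (x + RtoC (5 / 3)))%C)
    by (simpl; unfold Re in Hx; lra).
  field; split; [apply neq0_of_Re | now apply Cpoch_neq0].
  change (Re (RtoC (1 / 2) * (x + RtoC (5 / 3)))%C + INR k <> 0); lra.
Qed.

Lemma far_right_ev (x : C) : 0 < Re x -> exists K, forall k, (K <= k)%nat ->
  0 < Re (x + RtoC (2 * INR k))%C /\
  4 < Re ((x + RtoC (2 * INR k)) ^ 2 - RtoC 1)%C.
Proof.
intros Hx; destruct (nfloor_ex (Rabs (Im x) + 3)) as [K [_ HK]].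
{ assert (H := Rabs_pos (Im x)); lra. }
exists (S K); intros k Hk.
assert (H : Rabs (Im x) + 3 <= INR k).
{ apply Rlt_le; eapply Rlt_le_trans; [exact HK|].
  rewrite <- S_INR; apply le_INR, Hk. }
assert (H0 := Rabs_pos (Im x)).
assert (H2 : Im x ^ 2 = Rabs (Im x) ^ 2) by (rewrite RPow_abs, Rabs_pos_eq; nra).
destruct x as [s t]; simpl in *; split; nra.
Qed.

(** The combination is recessive at [x + 2 k] for one large [k], hence at [x].  As [l]
is unique, every larger [k] leads to the same [l], so that [l (x + 2 k) / l] is
known exactly and the estimate far to the right gives its asymptotics. *)
Lemma Recessive_exists (x : C) : 0 < Re x ->
  exists l, l <> RtoC 0 /\ Recessive x l /\
    Ccv (fun k => (Cpoch (RtoC (1 / 2) * (x + RtoC (5 / 3))) k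
                   / Cpoch (RtoC (1 / 2) * (x + RtoC (1 / 3))) k) ^ 3
                  / nC k ^ 2)%C (RtoC 2 / l)%C.
Proof.
intros Hx; set (a := (RtoC (1 / 2) * (x + RtoC (1 / 3)))%C).
set (b := (RtoC (1 / 2) * (x + RtoC (5 / 3)))%C).
assert (Ha : 0 < Re a) by (unfold a; simpl; unfold Re in Hx; lra).
assert (Hb : 0 < Re b) by (unfold b; simpl; unfold Re in Hx; lra).
destruct (far_right_ev x Hx) as [K HK].
assert (Hex : forall k, (K <= k)%nat -> exists l', Recessive (x + RtoC (2 * INR k))%C l' /\
  Cmod (l' - ((x + RtoC (2 * INR k)) ^ 2 - RtoC 1) / RtoC 2)%C <= 2).
{ intros k Hk; destruct (HK k Hk) as [H1 H2].
  destruct (Recessive_exists_right_half_plane _ H1) as [l' Hl']; [lra|].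
  exists l'; split; [exact Hl' | apply Recessive_far_right; auto; lra]. }
destruct (Hex K (le_n _)) as [l' [Hl' Hb']].
assert (Hl'0 : l' <> RtoC 0).
{ intros E; rewrite E in Hb'; destruct (HK K (le_n _)) as [_ H2].
  set (w := ((x + RtoC (2 * INR K)) ^ 2 - RtoC 1)%C) in *.
  replace (RtoC 0 - w / RtoC 2)%C with (RtoC (- / 2) * w)%C in Hb'
    by (rewrite RtoC_opp, RtoC_inv by lra; field; affine_neq0).
  assert (K1 := re_le_Cmod (RtoC (- / 2) * w)%C); rewrite re_scal_l in K1.
  rewrite Rabs_left in K1 by lra; lra. }
exists ((Cpoch a K / Cpoch b K) ^ 3 * l')%C.
assert (Hl0 : ((Cpoch a K / Cpoch b K) ^ 3 * l')%C <> RtoC 0).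
{ apply Cmult_neq_0; [apply Cpow_nz, Cmult_neq_0|exact Hl'0];
    [|apply Cinv_neq_0]; now apply Cpoch_neq0. }
assert (Hl := Recessive_shift x l' K Hx Hl'); fold a b in Hl.
set (l := ((Cpoch a K / Cpoch b K) ^ 3 * l')%C) in *.
split; [exact Hl0 | split; [exact Hl|]].
set (P := fun k => ((Cpoch b k / Cpoch a k) ^ 3)%C).
change (Ccv (fun k => P k / nC k ^ 2)%C (RtoC 2 / l)%C).
assert (Hn0 := Ccv_inv_nC).
set (g := fun k => (((x + RtoC (2 * INR k)) ^ 2 - RtoC 1) / RtoC 2)%C).
assert (Hg : Ccv (fun k => g k / nC k ^ 2)%C (RtoC 2)).
{ apply Ccv_eq with (((x * RtoC 0 + RtoC 2) ^ 2 - RtoC 0 * RtoC 0) * (/ RtoC 2))%C;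
    [field; affine_neq0|].
  apply Ccv_ext_ev with (fun k =>
    ((x * / nC k + RtoC 2) ^ 2 - / nC k * / nC k) * (/ RtoC 2))%C; [|ccv].
  exists 1%nat; intros k Hk; assert (Hn := nC_neq0 k Hk).
  unfold g; rewrite RtoC_mult; fold (nC k); field; exact Hn. }
assert (Hd : Ccv (fun k => (P k * l - g k) / nC k ^ 2)%C (RtoC 0)).
{ apply Ccv_le with (fun k => 2 * Cmod (/ nC k)%C ^ 2).
  - exists (S K); intros k Hk; destruct (Hex k ltac:(lia)) as [m [Hm Hmb]].
    fold (g k) in Hmb.
    assert (Em := Recessive_unique _ _ _ Hx (Recessive_shift x m k Hx Hm) Hl); fold a b in Em.
    assert (Pa := Cpoch_neq0 a k Ha); assert (Pb := Cpoch_neq0 b k Hb).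
    assert (Em' : (P k * l)%C = m) by (rewrite <- Em; unfold P; field; auto).
    rewrite Em'; assert (Hn : nC k <> RtoC 0) by (apply nC_neq0; lia).
    replace ((m - g k) / nC k ^ 2 - RtoC 0)%C with ((m - g k) * (/ nC k) ^ 2)%C
      by (field; exact Hn).
    rewrite Cmod_mult, Cmod_pow.
    apply Rmult_le_compat_r; [apply pow2_ge_0 | exact Hmb].
  - assert (Hp := Ccv_Cmod _ _ (Ccv_pow _ _ 2 Hn0)).
    replace 0 with (2 * Cmod (RtoC 0 ^ 2)%C)
      by (simpl Cpow; rewrite Cmult_0_l, Cmod_0; ring).
    apply is_lim_seq_mult'; [apply is_lim_seq_const|].
    apply is_lim_seq_ext with (2 := Hp); intros n; apply Cmod_pow. }
apply Ccv_eq with ((RtoC 0 + RtoC 2) * / l)%C; [field; exact Hl0|].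
apply Ccv_ext_ev with (fun k =>
  ((P k * l - g k) / nC k ^ 2 + g k / nC k ^ 2) * / l)%C.
- exists 1%nat; intros k Hk; assert (Hn := nC_neq0 k Hk); field; auto.
- apply Ccv_mult; [now apply Ccv_plus | apply Ccv_const].
Qed.

Theorem corollary1p6 (x : C) (hx : 0 < Re x) :
  exists l1 l2 : C,
    is_cf ((x ^ 2 - RtoC (1 / 9)) / RtoC 2)%C kappa (c x) l1 /\
    is_cf ((x ^ 2 - RtoC 1) / RtoC 2)%C nu (d x) l2 /\
    l1 <> RtoC 0 /\ l2 <> RtoC 0 /\
    (Gamma (RtoC (1 / 2) * (x + RtoC (1 / 3))) ^ 3 /
     Gamma (RtoC (1 / 2) * (x + RtoC (5 / 3))) ^ 3 = RtoC 2 / l1)%C /\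
    (RtoC 2 / l1 = RtoC 2 / l2)%C.
Proof.
destruct (Recessive_exists x hx) as [l [Hl0 [Hl Hlim]]].
exists l, l; repeat split; try assumption;
  try (apply (is_cf_kappa x l hx Hl)); try (apply (is_cf_nu x l hx Hl)).
set (a := (RtoC (1 / 2) * (x + RtoC (1 / 3)))%C) in *.
set (b := (RtoC (1 / 2) * (x + RtoC (5 / 3)))%C) in *.
assert (Ha : 0 < Re a) by (unfold a; simpl; unfold Re in hx; lra).
assert (Eb : b = (a + RtoC (2 / 3))%C).
{ unfold a, b; rewrite !RtoC_div by lra; field; repeat split; affine_neq0. }
assert (Hb : 0 < Re b) by (unfold b; simpl; unfold Re in hx; lra).
destruct (euler_cv a Ha) as [ga [_ Hga]], (euler_cv b Hb) as [gb [Hgb0 Hgb]].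
replace (Gamma a) with ga by (symmetry; apply (Ccv_C_Lim_seq _ _ Hga)).
replace (Gamma b) with gb by (symmetry; apply (Ccv_C_Lim_seq _ _ Hgb)).
transitivity ((ga / gb) ^ 3)%C; [field; exact Hgb0|].
apply Ccv_unique with (2 := Hlim).
apply Ccv_ext_ev with (2 := Ccv_pow _ _ 3 (Ccv_div _ _ _ _ Hgb0 Hga Hgb)).
exists 1%nat; intros k Hk; rewrite Eb; now apply euler_quotient.
Qed.
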